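(* Let $T>0$. Let $g\colon\mathbb{R}^{+}\to\mathbb{R}^{+}$ be a continuously differentiable function with $g(0)=0$ and $g(s)>0$ for $s>0$, such that $g'(s)>0$ for all $s>0$ and \[ \lim_{s\to0^{+}}\frac{g(s)}{s}=0,\qquad\lim_{s\to+\infty}\frac{g(s)}{s}=+\infty. \] Let $a\in L^{1}([0,T])$ be such that there exist $m\ge1$ closed and pairwise disjoint intervals $I_1,\dots,I_m\subseteq[0,T]$ for which, for $i=1,\dots,m$, $a(x)\ge0$ for a.e. $x\in I_i$ with $a\not\equiv0$ on $I_i$, and $a(x)\le0$ for a.e. $x\in[0,T]\setminus\bigcup_{i=1}^{m}I_i$. Then the problem \[ u''+a(x)g(u)=0\ \text{ on }(0,T),\qquad\mathscr{B}(u,u')=\underline{0}, \] has at least one positive solution if and only if $\int_{0}^{T}a(x)\,dx<0$. Here $\mathscr{B}(u,u')=\underline{0}$ denotes either of the two boundary conditions (Neumann or periodic) described in the context.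
   Context: $\mathbb{R}^{+}=[0,+\infty)$. The boundary operator is either $\mathscr{B}(u,u')=(u'(0),u'(T))$ (Neumann) or $\mathscr{B}(u,u')=(u(T)-u(0),u'(T)-u'(0))$ (periodic); the statement holds for each of the two choices. A solution is a continuously differentiable function $u\colon[0,T]\to\mathbb{R}$ with $u'$ absolutely continuous, satisfying the equation for a.e. $x\in[0,T]$ and the boundary condition. A positive solution is a solution with $u(x)>0$ for every $x\in[0,T]$. ''$a\not\equiv0$ on $I_i$'' means that $a$ is not a.e. zero on $I_i$. *)

(* Defs.v *)
From HB Require Import structures.
From mathcomp Require Import all_boot all_order all_algebra.
From mathcomp Require Import all_classical all_reals all_analysis.
Set Implicit Arguments.
Unset Strict Implicit.
Unset Printing Implicit Defensive.
Import Order.TTheory GRing.Theory Num.Theory.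
Import numFieldNormedType.Exports.
Local Open Scope classical_set_scope.
Local Open Scope ring_scope.

(* The difference quotient only sees points of D, so that at an endpoint of an
   interval D this is the one-sided derivative; the values of f outside D are
   irrelevant. *)
Definition has_derivative_in (R : realType) (D : set R) (f : R -> R) (x l : R)
    : Prop :=
  (f y - f x) / (y - x) @[y --> within D x^'] --> l.

Definition C1_in (R : realType) (D : set R) (f f' : R -> R) : Prop :=
  (forall x, D x -> has_derivative_in D f x (f' x)) /\
  {within D, continuous f'}.

(* Finite families of non-overlapping subintervals are given by their
   endpoints; disjointness is that of the open intervals, so adjacent
   subintervals may share an endpoint. *)
Definition absolutely_continuous (R : realType) (a b : R) (f : R -> R) : Prop :=
  forall e : R, 0 < e -> exists2 d : R, 0 < d &
    forall (n : nat) (s t : 'I_n -> R),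
      (forall i, a <= s i /\ s i <= t i /\ t i <= b) ->
      trivIset setT (fun i => `]s i, t i[%classic) ->
      \sum_(i < n) (t i - s i) < d ->
      \sum_(i < n) `|f (t i) - f (s i)| < e.

Inductive boundary_condition := Neumann | Periodic.

Definition boundary_operator (R : realType) (bc : boundary_condition) (T : R)
    (u u' : R -> R) : R * R :=
  match bc with
  | Neumann => (u' 0, u' T)
  | Periodic => (u T - u 0, u' T - u' 0)
  end.

(* For 0 < T the derivative u' is determined by u on [0, T]. *)
Definition is_solution (R : realType) (T : R) (a g : R -> R)
    (bc : boundary_condition) (u : R -> R) : Prop :=
  exists u' : R -> R,
    [/\ C1_in `[0, T] u u',
        absolutely_continuous 0 T u',
        {ae (@lebesgue_measure R), forall x, x \in `[0, T] ->
          exists u''x : R, has_derivative_in `[0, T] u' x u''x /\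
                           u''x + a x * g (u x) = 0} &
        boundary_operator bc T u u' = (0, 0)].

Definition is_positive_solution (R : realType) (T : R) (a g : R -> R)
    (bc : boundary_condition) (u : R -> R) : Prop :=
  is_solution T a g bc u /\ (forall x, x \in `[0, T] -> 0 < u x).

(* Main.v *)
(**
Necessity: if u is a positive solution, u'/g(u) + int_0^x a has the derivative
- g'(u) (u'/g(u))^2 <= 0 almost everywhere, and u'/g(u) takes the same value at
0 and T; hence int_0^T a <= 0, with equality only if u is constant, that is, if
a vanishes almost everywhere.

Sufficiency, without degree theory: replace g by 0 on the negative numbers and
by a linear function of large slope beyond a large level M.  The equation is
then globally Lipschitz, so that the initial value problem u(0) = c, u'(0) = d
has a global solution depending continuously on (c, d).
- A solution with c > 0 that reaches 0 stays nonpositive, with u'(T) < 0.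
- A positive solution is concave on each I_i and g is superlinear, so that u is
  bounded on I_i; by Gronwall's inequality (c, d) is bounded too, and a solution
  starting far from the origin reaches 0.
- For a solution that is small and whose derivative vanishes somewhere, u is
  nearly constant and u'(T) - u'(0) is close to - g(c) int a > 0.
In the Neumann case u'(T), as a function of c with d = 0, therefore changes
sign.  In the periodic case put F1 = u(T) - c and F2 = u'(T) - d on a rectangle
[eps, C] x [-D, D]: F1 < 0 on three of the sides, while on the side c = eps the
function F1 is positive at some d = delta, F2 > 0 at the zeros of F1 below delta
(small solutions) and F2 < 0 at those above delta (solutions coming down to
eps).  A Sperner-type parity argument yields a common zero of F1 and F2.
Finally u' = 0 at a maximum point of u and u is convex outside the I_i, so that
the bound on the I_i bounds u everywhere; thus u solves the original equation.
*)
Require Import Defs.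
From HB Require Import structures.
From mathcomp Require Import all_boot all_order all_algebra.
From mathcomp Require Import all_classical all_reals all_analysis.
From mathcomp Require Import measurable_realfun.
From mathcomp Require Import ring lra.
Set Implicit Arguments.
Unset Strict Implicit.
Unset Printing Implicit Defensive.
Import Order.TTheory GRing.Theory Num.Theory.
Import numFieldNormedType.Exports.
Local Open Scope classical_set_scope.
Local Open Scope ring_scope.

(* Hypotheses older than S may be section variables, which must not be cleared. *)
Ltac lra_from S :=
  repeat match goal with
  | H : ?P |- _ => tryif constr_eq H S then fail 1 else
      lazymatch P with
      | is_true _ => fail
      | _ = _ => fail
      | _ /\ _ => fail
      | _ => clear H
      end
  end; lra.

(** * Absolutely continuous functions *)

(** Apply the step at the supremum of the points where [P] holds: it carries [P] beyond the supremum
    unless that is [b]. Since [y] and [y'] straddle [t], the interval can be crossed in pieces that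
    are fine with respect to a gauge [r] depending on [t]. *)
Lemma interval_induction (R : realType) (a b : R) (P : R -> Prop) :
  a <= b -> P a ->
  (forall t, a <= t <= b -> exists2 r : R, 0 < r &
     forall y y', a <= y <= t -> t <= y' <= b -> t - r < y -> y' < t + r ->
       P y -> P y') ->
  P b.
Proof.
move=> ab Pa step.
pose S := [set t | a <= t <= b /\ P t].
have supS : has_sup S.
  by split; [exists a; rewrite /S/= lexx|exists b => t [/andP[]]].
have sab : a <= sup S <= b.
  rewrite sup_upper_bound//=; last by rewrite /S/= lexx.
  by apply: sup_le_ub; [case: supS|move=> t [/andP[]]].
have [r r0 ext] := step _ sab.
have [y [/andP[ay yb] Py] ry] := sup_adherent r0 supS.
have yS : y <= sup S by apply: sup_upper_bound => //; split => //; rewrite ay yb.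
have [sb|bs] := ltP (sup S + r / 2) b.
  have /ext : a <= y <= sup S by rewrite ay.
  move=> /(_ (sup S + r / 2)) h.
  have : S (sup S + r / 2).
    split; first by lra.
    by apply: h => //; lra.
  by move=> /(sup_upper_bound supS); lra.
have /ext : a <= y <= sup S by rewrite ay.
by move=> /(_ b); apply => //; lra.
Qed.

(** The quotient is multiplied out, so that the estimate also holds at [y = x]. *)
Lemma has_derivative_inP (R : realType) (D : set R) (f : R -> R) (x l : R) :
  has_derivative_in D f x l <-> forall e, 0 < e -> exists2 d, 0 < d &
    forall y, D y -> `|y - x| < d -> `|f y - f x - l * (y - x)| <= e * `|y - x|.
Proof.
split=> [/cvgrPdist_le H e e0|H].
  have := H e e0; rewrite near_withinE => /nbhs_ballP[d d0 Hd].
  exists d => // y Dy yx; have [->|yx0] := eqVneq y x.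
    by rewrite !subrr mulr0 subrr normr0 mulr0.
  have xy : ball x d y by rewrite -ball_normE/= distrC.
  have yx1 : y - x != 0 by rewrite subr_eq0.
  have h := Hd y xy yx0 Dy.
  rewrite -(ler_pM2r (_ : 0 < `|y - x|)) ?normr_gt0// -normrM in h.
  by rewrite mulrBl divfK// distrC in h.
apply/cvgrPdist_le => e e0; have [d d0 Hd] := H e e0.
rewrite near_withinE; apply/nbhs_ballP; exists d => // y.
rewrite -ball_normE/= distrC => yxd yx Dy.
have yx1 : y - x != 0 by rewrite subr_eq0.
rewrite -(ler_pM2r (_ : 0 < `|y - x|)) ?normr_gt0// -normrM.
by rewrite mulrBl divfK// distrC; exact: Hd.
Qed.

Lemma is_derive1P (R : realType) (f : R -> R) (x l : R) :
  is_derive x 1 f l <-> forall e, 0 < e -> exists2 d, 0 < d &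
    forall y, `|y - x| < d -> `|f y - f x - l * (y - x)| <= e * `|y - x|.
Proof.
have E : is_derive x 1 f l <->
    (fun h => h^-1 *: ((f \o shift x) (h *: 1) - f x)) @ 0^' --> l.
  split=> [[fx <-]//|H]; split; first by apply/cvg_ex; exists l.
  exact/cvg_lim.
rewrite E; split=> [/cvgrPdist_le H e e0|H].
  have /nbhs_ballP[d d0 Hd] := H e e0.
  exists d => // y yx; have [->|yx0] := eqVneq y x.
    by rewrite !subrr mulr0 subrr normr0 mulr0.
  have yx1 : y - x != 0 by rewrite subr_eq0.
  have xy : ball 0 d (y - x) by rewrite -ball_normE/= sub0r normrN.
  have /= h := Hd _ xy yx1.
  rewrite scaler1 subrK -(ler_pM2r (_ : 0 < `|y - x|)) ?normr_gt0// -normrM in h.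
  by rewrite mulrBl [_^-1 * _ * _]mulrAC mulVf// mul1r distrC in h.
apply/cvgrPdist_le => e e0; have [d d0 Hd] := H e e0.
apply/nbhs_ballP; exists d => // h.
rewrite -ball_normE/= sub0r normrN => hd h0.
have := Hd (h + x); rewrite addrK scaler1 => /(_ hd).
move=> h1; rewrite -(ler_pM2r (_ : 0 < `|h|)) ?normr_gt0// -normrM.
by rewrite mulrBl [_^-1 * _ * _]mulrAC mulVf// mul1r distrC.
Qed.

Lemma mu_itvoo (R : realType) (x y : R) : x <= y ->
  @lebesgue_measure R `]x, y[%classic = (y - x)%:E.
Proof.
rewrite lebesgue_measure_itv/= lte_fin EFinB.
by rewrite le_eqVlt => /predU1P[->|->//]; rewrite ltxx subee.
Qed.

(** * Monotonicity from an almost everywhere nonnegative derivative *)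

Section ac_nondecreasing.
Variable R : realType.
Local Notation mu := (@lebesgue_measure R).
Implicit Types (a b : R) (F : R -> R).

(** Stored from right to left, so that an interval to the right of all the others is added at the
    head. *)
Let chain (a t : R) (U : set R) (s : seq (R * R)) :=
  [/\ all (fun p => [&& a <= p.1, p.1 <= p.2 & p.2 <= t]) s,
      pairwise (fun p q => q.2 <= p.1) s &
      forall p, p \in s -> `]p.1, p.2[%classic `<=` U].

Let chain_sum F (s : seq (R * R)) : R := \sum_(p <- s) `|F p.2 - F p.1|.

Let chainW (a t t' : R) (U : set R) (s : seq (R * R)) : t <= t' -> chain a t U s -> chain a t' U s.
Proof.
move=> tt' [h1 h2 h3]; split => //; apply: sub_all h1 => p /and3P[-> ->] /=.
by move=> /le_trans; exact.
Qed.

Let chain_cons (a t t' : R) (U : set R) (s : seq (R * R)) : a <= t -> t <= t' -> `]t, t'[%classic `<=` U ->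
  chain a t U s -> chain a t' U ((t, t') :: s).
Proof.
move=> at_ tt' tU cs; have [h1 _ _] := chainW tt' cs.
case: cs => h0 h2 h3; split.
- by rewrite /= lexx at_ tt'.
- rewrite /= h2 andbT; apply: sub_all h0 => p /and3P[_ _].
  by [].
- by move=> p; rewrite inE => /predU1P[->//|]; exact: h3.
Qed.

(** The intervals are disjoint and contained in [U], so that their total length is at most the
    measure of [U]. *)
Let chain_small a b F (e d : R) (U : set R) (s : seq (R * R)) :
  (forall (n : nat) (s t : 'I_n -> R),
      (forall i, a <= s i /\ s i <= t i /\ t i <= b) ->
      trivIset setT (fun i => `]s i, t i[%classic) ->
      \sum_(i < n) (t i - s i) < d ->
      \sum_(i < n) `|F (t i) - F (s i)| < e) ->
  open U -> (mu U < d%:E)%E -> chain a b U s -> chain_sum F s < e.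
Proof.
move=> Fac oU Ud [h1 h2 h3].
rewrite /chain_sum (big_nth (0, 0)) big_mkord.
have trs : trivIset setT
    (fun i : 'I_(size s) => `](nth (0, 0) s i).1, (nth (0, 0) s i).2[%classic).
  have H (i j : 'I_(size s)) : (i < j)%N ->
      ~ (`](nth (0, 0) s i).1, (nth (0, 0) s i).2[%classic `&`
       `](nth (0, 0) s j).1, (nth (0, 0) s j).2[%classic !=set0).
    move=> ij [x []]; rewrite /= !in_itv/= => /andP[xi1 xi2] /andP[xj1 xj2].
    have /(pairwiseP (0, 0)) := h2.
    move=> /(_ i j); rewrite !inE => /(_ (ltn_ord i) (ltn_ord j) ij).
    by lra.
  move=> i j _ _ ne; apply/eqP; case: (ltngtP i j) => [ij|ji|/val_inj->//].
    by case: (H _ _ ij).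
  by case: (H _ _ ji); rewrite setIC.
apply: (Fac _ (fun i => (nth (0, 0) s i).1) (fun i => (nth (0, 0) s i).2)) => //.
  move=> i; have := all_nthP (0, 0) h1 _ (ltn_ord i).
  by move=> /and3P[].
rewrite -lte_fin; apply: le_lt_trans Ud.
have := @measure_bigsetU_ord _ _ _ mu _ xpredT _
  (fun i => measurable_itv `](nth (0, 0) s i).1, (nth (0, 0) s i).2[) trs.
rewrite -sumEFin => mE; rewrite [leLHS](_ : _ =
  mu (\big[setU/set0]_(i < size s)
    `](nth (0, 0) s i).1, (nth (0, 0) s i).2[%classic)).
  apply: le_measure; rewrite ?inE.
  - by apply: bigsetU_measurable => i _; exact: measurable_itv.
  - exact: open_measurable.
  - rewrite -bigcup_seq => x [i _]; apply: h3.
    by rewrite mem_nth.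
rewrite mE; apply: eq_bigr => i _.
apply/esym; apply: mu_itvoo.
by have /and3P[] := all_nthP (0, 0) h1 _ (ltn_ord i).
Qed.

(* Intervals around points of the exceptional null set lie in an open set of
   small measure, where absolute continuity controls F; around the other points
   the derivative does. *)
Lemma ac_nondecreasing a b F : a <= b -> absolutely_continuous a b F ->
  {ae mu, forall x, x \in `]a, b[ -> exists2 l, 0 <= l & is_derive x 1 F l} ->
  F a <= F b.
Proof.
move=> ab Fac [N [mN N0 FN]].
suff H e : 0 < e -> F a - F b <= e * (b - a + 1).
  rewrite -subr_le0 leNgt; apply/negP => Fab.
  have b1 : 0 < b - a + 1 by lra_from a.
  have := H ((F a - F b) / (b - a + 1) / 2).
  rewrite -[X in _ <= X]mulrA [_^-1 * (b - a + 1)]mulrC mulrA divfK ?gt_eqF// => h.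
  have := h (divr_gt0 (divr_gt0 Fab b1) (ltr0Sn _ _)).
  by lra_from a.
move=> e0.
have [d d0 Fd] := Fac e e0.
(* The endpoints join the exceptional set, because the derivative is only given inside the
   interval. *)
have mN' : measurable (N `|` [set a; b]).
  by apply: measurableU => //; apply: measurableU; exact: measurable_set1.
have N'0 : mu (N `|` [set a; b]) = 0%E.
  apply: measure_negligible => //; apply: negligibleU; first exact/negligibleP.
  by apply: negligibleU; apply/negligibleP => //; exact: lebesgue_measure_set1.
have N'y : (mu (N `|` [set a; b]) < +oo)%E by rewrite N'0.
have [U [oU NU muU']] := lebesgue_regularity_outer mN' N'y d0.
have mU := open_measurable oU.
have muU : (mu U < d%:E)%E.
  apply: le_lt_trans muU'.
  rewrite -[X in (mu X <= _)%E](setDUK NU).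
  have := @measureU2 _ _ _ mu _ _ mN' (measurableD mU mN').
  by rewrite -[X in (_ <= X + _)%E]/(mu (N `|` [set a; b])) N'0 add0e.
(* The loss of [F] up to [t] is charged to the length, at rate [e], and to the variation over a
   chain in [U]; the latter is finally below [e], whence the [+ 1] in the bound to be shown. *)
pose P t := exists2 s, chain a t U s &
  F a - F t <= e * (t - a) + chain_sum F s.
have : P b.
  apply: (@interval_induction R a b) => //.
    exists [::]; first by split.
    by rewrite /chain_sum big_nil !subrr mulr0 add0r.
  move=> t tab.
  have [tN|tN] := pselect ((N `|` [set a; b]) t).
    have : nbhs t U by apply: open_nbhs_nbhs; split => //; exact: NU.
    rewrite -nbhs_ballE => -[r /= r0 rU]; exists r => // y y' yt ty' ry ry'.
    move=> [s cs Fs]; exists ((y, y') :: s).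
      apply: chain_cons => //; [lra_from a|lra_from a|move=> z/=; rewrite in_itv/= => yz].
      by apply: rU; rewrite /ball/= ltr_distl; lra_from a.
    rewrite /chain_sum big_cons -/(chain_sum F s) /=.
    have := ler_norm (F y - F y'); rewrite distrC.
    have : e * (y - a) <= e * (y' - a) by rewrite ler_pM2l//; lra_from a.
    lra_from a.
  have [l l0 Fl] : exists2 l, 0 <= l & is_derive t 1 F l.
    have [] := pselect (t \in `]a, b[ -> exists2 l, 0 <= l & is_derive t 1 F l).
      apply; rewrite in_itv/= !lt_neqAle; case/andP: tab => -> ->.
      rewrite !andbT; apply/andP; split.
        by apply/negP => /eqP at_; apply: tN; right; left.
      by apply/negP => /eqP at_; apply: tN; right; right.
    by move=> ht; exfalso; apply: tN; left; exact: FN.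
  have /is_derive1P/(_ e e0)[r r0 Hr] := Fl.
  exists r => // y y' yt ty' ry ry' [s cs Fs]; exists s.
    by apply: chainW cs; lra_from a.
  have := Hr y; rewrite ltr_distl => /(_ ltac:(lra_from a)).
  have := Hr y'; rewrite ltr_distl => /(_ ltac:(lra_from a)).
  rewrite (ger0_norm (_ : 0 <= y' - t)) ?(ler0_norm (_ : y - t <= 0)); [|lra_from a..].
  rewrite !ler_distl.
  have : 0 <= l * (y' - t) by apply: mulr_ge0 => //; lra_from a.
  have : 0 <= l * (t - y) by apply: mulr_ge0 => //; lra_from a.
  lra_from a.
move=> [s cs Fs].
have := chain_small Fd oU muU cs.
lra_from a.
Qed.
End ac_nondecreasing.

(** * Stability of absolute continuity, and primitives of integrable functions *)

Section absolutely_continuous.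
Variable R : realType.
Local Notation mu := (@lebesgue_measure R).
Implicit Types (a b K : R) (F G H f : R -> R).

Lemma ae_imp (P Q : R -> Prop) : (forall x, P x -> Q x) ->
  {ae mu, forall x, P x} -> {ae mu, forall x, Q x}.
Proof. by move=> PQ; apply: filterS; first exact: (ae_filter_ringOfSetsType mu). Qed.

Lemma ae_and (P Q : R -> Prop) : {ae mu, forall x, P x} -> {ae mu, forall x, Q x} ->
  {ae mu, forall x, P x /\ Q x}.
Proof.
by move=> HP HQ; apply: filterS2 HP HQ => //; exact: (ae_filter_ringOfSetsType mu).
Qed.

(** A single domination criterion from which Lipschitz functions, sums, multiples, products and
    exponentials are treated. *)
Lemma ac_le_lincomb a b F G H K L : 0 <= K -> 0 <= L ->
  absolutely_continuous a b F -> absolutely_continuous a b G ->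
  (forall s t, a <= s -> s <= t -> t <= b ->
    `|H t - H s| <= K * `|F t - F s| + L * `|G t - G s|) ->
  absolutely_continuous a b H.
Proof.
move=> K0 L0 Fac Gac HFG e e0.
pose e' := e / (2 * (K + L + 1)).
have KL : 0 < K + L + 1 by lra.
have e'0 : 0 < e' by rewrite divr_gt0// mulr_gt0.
have [d1 d10 Hd1] := Fac _ e'0; have [d2 d20 Hd2] := Gac _ e'0.
exists (Num.min d1 d2); first by rewrite lt_min d10.
move=> n s t st tr; rewrite lt_min => /andP[h1 h2].
have {}h1 := Hd1 _ _ _ st tr h1; have {}h2 := Hd2 _ _ _ st tr h2.
apply: (@le_lt_trans _ _ (K * (\sum_(i < n) `|F (t i) - F (s i)|) +
   L * (\sum_(i < n) `|G (t i) - G (s i)|))).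
  rewrite !mulr_sumr -big_split/=; apply: ler_sum => i _.
  by have [? [? ?]] := st i; apply: HFG.
have e'E : e = 2 * (K + L + 1) * e' by rewrite /e' mulrC divfK// gt_eqF// mulr_gt0.
rewrite e'E.
have : K * \sum_(i < n) `|F (t i) - F (s i)| <= K * e' by rewrite ler_wpM2l// ltW.
have : L * \sum_(i < n) `|G (t i) - G (s i)| <= L * e' by rewrite ler_wpM2l// ltW.
have : 0 <= K * e' by rewrite mulr_ge0// ltW.
have : 0 <= L * e' by rewrite mulr_ge0// ltW.
lra.
Qed.

Lemma ac_id a b : absolutely_continuous a b id.
Proof.
move=> e e0; exists e => // n s t st _; apply: le_lt_trans.
by apply: ler_sum => i _; have [_ [? _]] := st i; rewrite ger0_norm// subr_ge0.
Qed.

Lemma ac_lipschitz a b H K : 0 <= K ->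
  (forall s t, a <= s -> s <= t -> t <= b -> `|H t - H s| <= K * `|t - s|) ->
  absolutely_continuous a b H.
Proof.
move=> K0 HK; apply: (ac_le_lincomb K0 K0 (@ac_id a b) (@ac_id a b)) => s t as_ st tb.
by apply: le_trans (HK _ _ as_ st tb) _; rewrite lerDl mulr_ge0.
Qed.

Lemma acD a b F G : absolutely_continuous a b F -> absolutely_continuous a b G ->
  absolutely_continuous a b (F \+ G).
Proof.
move=> Fac Gac; apply: (ac_le_lincomb ler01 ler01 Fac Gac) => s t _ _ _ /=.
by rewrite !mul1r opprD addrACA ler_normD.
Qed.

Lemma acN a b F : absolutely_continuous a b F -> absolutely_continuous a b (\- F).
Proof.
move=> Fac; apply: (ac_le_lincomb ler01 (lexx 0) Fac Fac) => s t _ _ _ /=.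
by rewrite mul1r mul0r addr0 -opprD normrN.
Qed.

Lemma acM a b F G K L :
  (forall x, a <= x <= b -> `|F x| <= K) -> (forall x, a <= x <= b -> `|G x| <= L) ->
  absolutely_continuous a b F -> absolutely_continuous a b G ->
  absolutely_continuous a b (F \* G).
Proof.
move=> FK GL Fac Gac; have [ba|ab] := ltP b a.
  (* For [b < a] the constants [K] and [L] may be negative, but only the empty family is
     admissible. *)
  move=> e e0; exists 1 => // n s t st; case: n s t st => [s t _ _ _|n s t st].
    by rewrite big_ord0.
  by have [? [? ?]] := st ord0; exfalso; lra.
have aab : a <= a <= b by rewrite lexx.
have K0 : 0 <= K by apply: le_trans (FK _ aab).
have L0 : 0 <= L by apply: le_trans (GL _ aab).
apply: (ac_le_lincomb L0 K0 Fac Gac) => s t as_ st tb /=.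
rewrite (_ : _ - _ = (F t - F s) * G t + F s * (G t - G s)); last by ring.
apply: (le_trans (ler_normD _ _)); rewrite !normrM lerD//.
  by rewrite mulrC ler_wpM2r//; apply: GL; lra.
by rewrite ler_wpM2r//; apply: FK; lra.
Qed.

Lemma acS a b c d F : a <= c -> d <= b -> absolutely_continuous a b F ->
  absolutely_continuous c d F.
Proof.
move=> ac db Fac e e0; have [r r0 Hr] := Fac e e0; exists r => // n s t st.
by apply: Hr => i; have [? [? ?]] := st i; split; [|split]; lra.
Qed.

(** For a function that vanishes on the negative half-line this is the integral from 0. *)
Definition primitive f t : R := \int[mu]_(x in `]-oo, t]) f x.

Section primitive.
Variable f : R -> R.
Hypothesis fi : mu.-integrable setT (EFin \o f).

Let fiS (D : set R) : measurable D -> mu.-integrable D (EFin \o f).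
Proof. by move=> mD; exact: integrableS fi. Qed.

Lemma primitiveB s t : s <= t ->
  primitive f t - primitive f s = \int[mu]_(x in `]s, t]) f x.
Proof.
move=> st; rewrite /primitive Rintegral_itvB ?bnd_simp//.
by apply: fiS; exact: measurable_itv.
Qed.

(** The integral of [|f|] over a set of small measure is small; the set is the union of the given
    intervals. *)
Lemma ac_primitive a b : absolutely_continuous a b (primitive f).
Proof.
move=> e e0; have [d [d0 Hd]] := integral_normr_continuous fi e0.
exists d => // n s t st tr std.
pose I (i : 'I_n) : set R := `]s i, t i[%classic.
have mI i : measurable (I i) by exact: measurable_itv.
pose U := \big[setU/set0]_(i < n) I i.
have mU : measurable U by apply: bigsetU_measurable.
have UE : mu U = \sum_(i < n) (t i - s i)%:E.
  have -> := @measure_bigsetU_ord _ _ _ mu n xpredT I mI tr.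
  by apply: eq_bigr => i _; apply: mu_itvoo; have [? [? ?]] := st i.
have Ud : (mu U < d%:E)%E by rewrite UE sumEFin lte_fin.
apply: (@le_lt_trans _ _ (\int[mu]_(x in U) `|f x|)); last exact: Hd.
have fnI (D : set R) : measurable D -> mu.-integrable D (EFin \o (fun x => `|f x|)).
  by move=> mD; apply: integrable_norm; exact: fiS.
have -> : \int[mu]_(x in U) `|f x| = \sum_(i < n) \int[mu]_(x in I i) `|f x|.
  apply/EFin_inj; rewrite /Rintegral fineK; last first.
    by apply: integrable_fin_num => //; exact: fnI.
  rewrite integral_bigsetU_EFin//=; last 3 first.
  - exact: index_enum_uniq.
  - by apply: sub_trivIset tr.
  - exact: (measurable_int mu (fnI _ mU)).
  rewrite -sumEFin; apply: eq_bigr => i _; rewrite fineK//.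
  by apply: integrable_fin_num; [exact: mI|exact: fnI].
apply: ler_sum => i _; have [_ [st' _]] := st i.
rewrite primitiveB//; apply: le_trans (le_normr_Rintegral _ _) _ => //.
  exact: fiS.
by rewrite -Rintegral_itv_bndo_bndc//; exact: fnI.
Qed.

Lemma primitive_is_derive : {ae mu, forall x : R, is_derive x (1 : R) (primitive f) (f x)}.
Proof.
have := @FTC1Ny R f (fun y => fiS (measurable_itv _)).
move=> H; have /H : locally_integrable setT f.
  by apply: open_integrable_locally => //; exact: openT.
apply: ae_imp => x /= [dx <-]; rewrite derive1E; exact/derivableP.
Qed.

Lemma primitive_continuous : continuous (primitive f).
Proof.
move=> x; apply/cvgrPdist_le => e e0.
have [d d0 Hd] := @ac_primitive (x - 1) (x + 1) e e0.
apply/nbhs_ballP; exists (Num.min 1 d) => [|y]; first by rewrite /= lt_min ltr01.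
rewrite /ball/= lt_min => /andP[xy1 xyd].
have := Hd 1%N (fun=> Num.min x y) (fun=> Num.max x y).
rewrite !big_ord1 => H; apply/ltW; move: H.
have tr (p q : R) : trivIset setT (fun _ : 'I_1 => `]p, q[%classic).
  by move=> i j _ _ _; rewrite !ord1.
rewrite ltr_distl in xy1; rewrite ltr_distl in xyd.
have [xy|yx] := leP x y => H.
  rewrite distrC; apply: H; [|exact: tr|lra].
  by move=> _; split; [|split]; lra.
apply: H; [|exact: tr|lra].
by move=> _; split; [|split]; lra.
Qed.

End primitive.
End absolutely_continuous.

(** * Absolutely continuous functions with their derivatives; Gronwall's inequality *)

Section acd.
Variable R : realType.
Local Notation mu := (@lebesgue_measure R).
Implicit Types (a b K : R) (F G H f g h : R -> R).

(** On intervals shorter than the [d] that belongs to [e = 1] the function varies by less than 1;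
    interval induction adds up the pieces. *)
Lemma ac_bounded a b F : absolutely_continuous a b F ->
  exists K, forall x, a <= x <= b -> `|F x| <= K.
Proof.
move=> Fac; have [ba|ab] := ltP b a; first by exists 0 => x; lra.
have [d d0 Hd] := Fac 1 ltr01.
have H x y : a <= x -> x <= y -> y <= b -> y - x < d -> `|F y - F x| < 1.
  move=> ax xy yb yx; have := Hd 1%N (fun=> x) (fun=> y); rewrite !big_ord1; apply => //.
  by move=> i j _ _ _; rewrite !ord1.
apply: (@interval_induction R a b (fun t =>
    exists K, forall x, a <= x <= t -> `|F x| <= K)) => //.
  exists `|F a| => x ax; have -> : x = a by lra.
  by [].
move=> t tab; exists (d / 2) => [|y y' yt ty' ry ry' [K HK]]; first lra.
exists (K + 1) => x /andP[ax xy'].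
have [xy|yx] := leP x y; first by have := HK x; rewrite ax xy => /(_ isT); lra.
have := H y x ltac:(lra) ltac:(lra) ltac:(lra) ltac:(lra).
have := HK y ltac:(lra).
have := ler_normD (F x - F y) (F y); rewrite subrK; lra.
Qed.

(** The derivative [f] is any almost everywhere representative, with no condition outside the
    interval, so that the rules of calculus need no integrability of [f]. *)
Definition acd a b F f := absolutely_continuous a b F /\
  {ae mu, forall x : R, x \in `]a, b[ -> is_derive x (1 : R) F (f x)}.

Lemma acd_nondecreasing a b F f : a <= b -> acd a b F f ->
  {ae mu, forall x : R, x \in `]a, b[ -> 0 <= f x} -> F a <= F b.
Proof.
move=> ab [Fac Fd] f0; apply: ac_nondecreasing => //.
have := ae_and Fd f0; apply: ae_imp => x [h1 h2] xab.
by exists (f x); [exact: h2|exact: h1].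
Qed.

Lemma acdS a b c d F f : a <= c -> d <= b -> acd a b F f -> acd c d F f.
Proof.
move=> ac db [Fac Fd]; split; first exact: acS Fac.
by apply: ae_imp Fd => x h xcd; apply: h; move: xcd; rewrite !in_itv/=; lra.
Qed.

Lemma acd_ae a b F f g : acd a b F f ->
  {ae mu, forall x : R, x \in `]a, b[ -> f x = g x} -> acd a b F g.
Proof.
move=> [Fac Fd] fg; split => //; have := ae_and Fd fg; apply: ae_imp.
by move=> x [h1 h2] xab; rewrite -h2//; exact: h1.
Qed.

Lemma acdD a b F f G g : acd a b F f -> acd a b G g -> acd a b (F \+ G) (f \+ g).
Proof.
move=> [Fac Fd] [Gac Gd]; split; first exact: acD.
by have := ae_and Fd Gd; apply: ae_imp => x [h1 h2] xab; apply: is_deriveD; auto.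
Qed.

Lemma acdN a b F f : acd a b F f -> acd a b (\- F) (\- f).
Proof.
move=> [Fac Fd]; split; first exact: acN.
by apply: ae_imp Fd => x h1 xab; apply: is_deriveN; auto.
Qed.

Lemma acdZ a b F f r : acd a b F f ->
  acd a b (fun x => r * F x) (fun x => r * f x).
Proof.
move=> [Fac Fd]; split.
  apply: (ac_le_lincomb (normr_ge0 r) (lexx 0) Fac Fac) => s t _ _ _.
  by rewrite mul0r addr0 -mulrBr normrM.
by apply: ae_imp Fd => x h1 xab; apply: is_deriveZ; auto.
Qed.

Lemma acdM a b F f G g : acd a b F f -> acd a b G g ->
  acd a b (F \* G) (fun x => F x * g x + G x * f x).
Proof.
move=> [Fac Fd] [Gac Gd]; split.
  have [K FK] := ac_bounded Fac; have [L GL] := ac_bounded Gac.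
  exact: acM FK GL Fac Gac.
by have := ae_and Fd Gd; apply: ae_imp => x [h1 h2] xab; apply: is_deriveM; auto.
Qed.

Lemma acd_C1 a b F f K : {within `[a, b], continuous F} ->
  (forall x, x \in `]a, b[ -> is_derive x 1 F (f x)) ->
  (forall x, x \in `]a, b[ -> `|f x| <= K) -> acd a b F f.
Proof.
move=> Fc Fd fK; split; last exact: aeW.
have [ba|ab] := leP b a.
  apply: (@ac_lipschitz _ _ _ _ 0) => // s t as_ st tb.
  have -> : s = t by lra.
  by rewrite !subrr normr0 mul0r.
(* Some point of the open interval is needed to see that [K] is nonnegative. *)
have mab : (a + b) / 2 \in `]a, b[ by rewrite in_itv/=; lra.
apply: (@ac_lipschitz _ _ _ _ K).
  by apply: le_trans (fK _ mab).
move=> s t as_ st tb; move: st; rewrite le_eqVlt => /predU1P[->|st].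
  by rewrite !subrr normr0 mulr0.
have sub x : x \in `]s, t[ -> x \in `]a, b[ by rewrite !in_itv/=; lra.
have [|c cst ->] := MVT st (fun x xst => Fd x (sub x xst)).
  apply: continuous_subspaceW Fc => x/=; rewrite !in_itv/=; lra.
by rewrite normrM ler_wpM2r//; exact/fK/sub.
Qed.

Lemma acd_id a b : acd a b id (cst 1).
Proof.
by split; [exact: ac_id|apply: aeW => x _; exact: is_derive_id].
Qed.

Lemma acd_cst a b k : acd a b (cst k) (cst 0).
Proof.
split; last by apply: aeW => x _; exact: is_derive_cst.
apply: (@ac_lipschitz _ _ _ _ 0) => // s t _ _ _.
by rewrite /= subrr normr0 mul0r.
Qed.

Lemma acd_primitive a b f : mu.-integrable setT (EFin \o f) ->
  acd a b (primitive f) f.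
Proof.
move=> fi; split; first exact: ac_primitive.
by apply: ae_imp (primitive_is_derive fi) => x h _.
Qed.

(** If [F <= K] on the interval, the exponential is Lipschitz with constant [expR K] on the values
    of [F]. *)
Lemma acd_exp a b F f : acd a b F f ->
  acd a b (fun x => expR (F x)) (fun x => expR (F x) * f x).
Proof.
move=> [Fac Fd]; split.
  have [K FK] := ac_bounded Fac.
  apply: (@ac_le_lincomb _ a b F F _ (expR K) 0) => //.
  have H x y : x <= y -> y <= K -> expR y - expR x <= expR K * (y - x).
    rewrite le_eqVlt => /predU1P[->|xy] yK; first by rewrite !subrr mulr0.
    have [|c] := MVT xy (fun z _ => is_derive_expR z).
      by apply: continuous_subspaceT => z; exact: continuous_expR.
    rewrite in_itv/= => cxy ->; rewrite ler_wpM2r//; first lra.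
    by rewrite ler_expR; lra.
  move=> s t as_ st tb; rewrite mul0r addr0.
  have tK := le_trans (ler_norm _) (FK t ltac:(lra)).
  have sK := le_trans (ler_norm _) (FK s ltac:(lra)).
  have [ts|st'] := leP (F t) (F s).
    rewrite distrC ger0_norm ?subr_ge0 ?ler_expR// distrC ger0_norm ?subr_ge0//.
    exact: H.
  rewrite ger0_norm ?subr_ge0 ?ler_expR ?(ltW st')// ger0_norm ?subr_ge0 ?(ltW st')//.
  by apply: H => //; exact: ltW.
by apply: ae_imp Fd => x h xab; have := h xab => ?; apply: is_derive1_comp.
Qed.

(** The product [Z x * expR (- A x)] has the derivative [expR (- A x) * (z x - k x * Z x) <= 0]. *)
Lemma gronwall a b Z z A k : a <= b -> acd a b Z z -> acd a b A k ->
  {ae mu, forall x : R, x \in `]a, b[ -> z x <= k x * Z x} ->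
  Z b * expR (- A b) <= Z a * expR (- A a).
Proof.
move=> ab Zd Ad zk.
rewrite -lerN2.
have := acd_nondecreasing ab (acdN (acdM Zd (acd_exp (acdN Ad)))); apply.
apply: ae_imp zk => x h /h {}h /=.
rewrite oppr_ge0 (_ : _ + _ = expR (- A x) * (z x - k x * Z x)); last by ring.
by rewrite mulr_ge0_le0 ?expR_ge0// subr_le0.
Qed.

(** The second, backward estimate is [gronwall] for [- Z] and [- A]. It will recover the initial
    data of a trajectory from its later values. *)
Lemma gronwall_sym a b Z z A k : a <= b -> acd a b Z z -> acd a b A k ->
  {ae mu, forall x : R, x \in `]a, b[ -> `|z x| <= k x * Z x} ->
  Z b <= Z a * expR (A b - A a) /\ Z a <= Z b * expR (A b - A a).
Proof.
move=> ab Zd Ad zk; split.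
  have := gronwall ab Zd Ad.
  rewrite -(ler_pM2r (expR_gt0 (A b))) -!mulrA -!expRD addNr expR0 mulr1.
  rewrite [- _ + _]addrC; apply.
  by apply: ae_imp zk => x h /h; apply: le_trans; exact: ler_norm.
have := gronwall ab (acdN Zd) (acdN Ad).
rewrite /= !opprK !mulNr lerN2.
rewrite -(ler_pM2r (expR_gt0 (- A a))) -!mulrA -!expRD subrr expR0 mulr1; apply.
apply: ae_imp zk => x h /h {}h /=.
by rewrite mulrNN; apply: le_trans h; rewrite -normrN; exact: ler_norm.
Qed.

(** The energy [p ^+ 2 + q ^+ 2] has a derivative of size at most [2 (1 + l) |p| |q|], hence at most
    [1 + l] times the energy. *)
Lemma gronwall_system a b p q q' l : a <= b -> mu.-integrable setT (EFin \o l) ->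
  (forall x, 0 <= l x) -> acd a b p q -> acd a b q q' ->
  {ae mu, forall x : R, x \in `]a, b[ -> `|q' x| <= l x * `|p x|} ->
  let B := expR (b - a + (primitive l b - primitive l a)) in
  p b ^+ 2 + q b ^+ 2 <= (p a ^+ 2 + q a ^+ 2) * B /\
  p a ^+ 2 + q a ^+ 2 <= (p b ^+ 2 + q b ^+ 2) * B.
Proof.
move=> ab li l0 pq qq' q'l B.
have := gronwall_sym ab (acdD (acdM pq pq) (acdM qq' qq'))
  (acdD (@acd_id a b) (acd_primitive a b li)).
rewrite /= -!expr2 opprD addrACA; apply.
apply: ae_imp q'l => x h /h {}h /=.
rewrite -!mulr2n -mulrnDl normrMn -expr2.
apply: (@le_trans _ _ ((`|p x| * `|q x| + `|q x| * (l x * `|p x|)) *+ 2)).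
  rewrite ler_wMn2r// (le_trans (ler_normD _ _))// !normrM lerD2l.
  by rewrite ler_wpM2l.
rewrite (_ : _ *+ 2 = (1 + l x) * (`|p x| * `|q x| *+ 2)); last by ring.
rewrite ler_wpM2l ?addr_ge0//.
rewrite -[X in _ <= X + _]real_normK ?num_real// -[X in _ <= _ + X]real_normK ?num_real//.
rewrite -subr_ge0 (_ : _ - _ = (`|p x| - `|q x|) ^+ 2) ?sqr_ge0//.
by ring.
Qed.

End acd.

Lemma Rintegral_cst_itv (R : realType) (x y r : R) : x <= y ->
  \int[@lebesgue_measure R]_(_ in `[x, y]) r = r * (y - x).
Proof.
move=> xy; rewrite Rintegral_cst//; congr (_ * _).
have E : @lebesgue_measure R `[x, y]%classic = (y - x)%:E.
  rewrite lebesgue_measure_itv/= lte_fin EFinB.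
  by move: xy; rewrite le_eqVlt => /predU1P[->|->//]; rewrite ltxx subee.
exact: (congr1 fine E).
Qed.

(** * Order and linearity of primitives *)

Section primitive_order.
Variable R : realType.
Local Notation mu := (@lebesgue_measure R).
Implicit Types f g : R -> R.

Let mNy (t : R) : measurable (`]-oo, t]%classic : set R).
Proof. exact: measurable_itv. Qed.

Let iNy f (t : R) : mu.-integrable setT (EFin \o f) ->
  mu.-integrable `]-oo, t]%classic (EFin \o f).
Proof. by move=> fi; exact: integrableS fi. Qed.

Lemma le_primitive f g t : mu.-integrable setT (EFin \o f) ->
  mu.-integrable setT (EFin \o g) -> (forall x, x <= t -> f x <= g x) ->
  primitive f t <= primitive g t.
Proof.
move=> fi gi fg; apply: le_Rintegral; do ?[exact: iNy|exact: mNy].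
by move=> x /=; rewrite in_itv/=; exact: fg.
Qed.

Lemma normr_primitive f t : mu.-integrable setT (EFin \o f) ->
  `|primitive f t| <= primitive (fun x => `|f x|) t.
Proof. by move=> fi; apply: le_normr_Rintegral => //; exact: iNy. Qed.

Lemma primitive_eq0 f t : (forall x, x <= t -> f x = 0) -> primitive f t = 0.
Proof.
move=> f0; rewrite /primitive (@eq_Rintegral _ _ _ mu _ (cst 0)).
  by rewrite Rintegral_cst// mul0r.
by move=> x; rewrite inE/= in_itv/= => /f0.
Qed.

Lemma primitive_ge0 f t : (forall x, 0 <= f x) -> 0 <= primitive f t.
Proof. by move=> f0; apply: Rintegral_ge0. Qed.

Lemma primitive_sub f g t : mu.-integrable setT (EFin \o f) ->
  mu.-integrable setT (EFin \o g) ->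
  primitive (fun x => f x - g x) t = primitive f t - primitive g t.
Proof. by move=> fi gi; apply: RintegralB => //; exact: iNy. Qed.

Lemma primitiveZl f t r : mu.-integrable setT (EFin \o f) ->
  primitive (fun x => r * f x) t = r * primitive f t.
Proof. by move=> fi; apply: RintegralZl => //; exact: iNy. Qed.

Lemma primitive_mono f s t : mu.-integrable setT (EFin \o f) ->
  (forall x, 0 <= f x) -> s <= t -> primitive f s <= primitive f t.
Proof.
by move=> fi f0 st; rewrite -subr_ge0 primitiveB//; exact: Rintegral_ge0.
Qed.

Lemma primitive_le_int f t : mu.-integrable setT (EFin \o f) ->
  (forall x, 0 <= f x) -> primitive f t <= \int[mu]_x f x.
Proof.
move=> fi f0; rewrite /primitive Rintegral_mkcond.
apply: le_Rintegral => //.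
  by rewrite -restrict_EFin; apply/integrable_restrict => //; rewrite setTI; exact: iNy.
by move=> x _; rewrite patchE; case: ifP.
Qed.

Lemma integrable_mul_bounded f g K : mu.-integrable setT (EFin \o f) ->
  continuous g -> (forall x, `|g x| <= K) ->
  mu.-integrable setT (EFin \o (fun x => f x * g x)).
Proof.
move=> fi gc gK.
have mg : measurable_fun setT g by exact: continuous_measurable_fun.
have bg : [bounded g x | x in [set: R]].
  exists K; split; first exact: num_real.
  by move=> M KM x _ /=; apply: le_trans (gK _) (ltW KM).
have := integrableMl measurableT fi mg bg.
by apply: eq_integrable.
Qed.

Lemma integrable_patch_bounded f (a b K : R) : continuous f -> (forall x, `|f x| <= K) ->
  mu.-integrable setT (EFin \o (f \_ `[a, b])).
Proof.
move=> fc fK; rewrite -restrict_EFin; apply/integrable_restrict => //; rewrite setTI.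
apply: continuous_compact_integrable; first exact: segment_compact.
exact: continuous_subspaceT.
Qed.

Lemma integrable_scale f r : mu.-integrable setT (EFin \o f) ->
  mu.-integrable setT (EFin \o (fun x => r * f x)).
Proof. by move=> fi; have := integrableZl measurableT r fi; apply: eq_integrable. Qed.

End primitive_order.

(** With [q n] the tail of the geometric series, [f n t - q n] increases, [f n t + q n] decreases,
    and every value of the former is below every value of the latter. The limit is the supremum of
    the former. *)
Lemma geometric_fun_limit (R : realType) (T : Type) (f : nat -> T -> R) (C : R) :
  (forall n t, `|f n.+1 t - f n t| <= C / 2 ^+ n) ->
  exists h, forall n t, `|h t - f n t| <= 2 * C / 2 ^+ n.
Proof.
move=> fC; pose q n : R := 2 * C / 2 ^+ n.
have qS n : q n.+1 + C / 2 ^+ n = q n.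
  by rewrite /q exprS; field; rewrite expf_neq0.
pose S t := [set y | exists n, y = f n t - q n].
have incr n t : f n t - q n <= f n.+1 t - q n.+1.
  by have := fC n t; rewrite ler_distl -(qS n); lra.
have decr n t : f n.+1 t + q n.+1 <= f n t + q n.
  by have := fC n t; rewrite ler_distl -(qS n); lra.
have incr' t := @homo_leq _ (fun n => f n t - q n) <=%R (@lexx _ _) (@le_trans _ _) (incr^~ t).
have decr' t := @homo_leq _ (fun n => f n t + q n) (fun x y => y <= x) (@lexx _ _)
  (fun y x z xy yz => le_trans yz xy) (decr^~ t).
have q0 (t : T) n : 0 <= q n.
  have := fC n t; have := normr_ge0 (f n.+1 t - f n t) => h1 h2.
  have := le_trans h1 h2; rewrite /q -mulrA => h; exact: mulr_ge0.
have cross n m (t : T) : f n t - q n <= f m t + q m.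
  have := incr' t n (maxn n m) (leq_maxl _ _).
  have /= := decr' t m (maxn n m) (leq_maxr _ _).
  have := q0 t (maxn n m); lra.
have supS (t : T) : has_sup (S t).
  split; first by exists (f 0%N t - q 0%N), 0%N.
  by exists (f 0%N t + q 0%N) => _ [n ->]; exact: cross.
exists (fun t => sup (S t)) => n t; rewrite -/(q n) ler_distl.
rewrite sup_upper_bound//=; last by exists n.
by apply: sup_le_ub; [case: (supS t)|move=> _ [m ->]; exact: cross].
Qed.

(** * Picard iteration *)

Lemma geometric_le0 (R : realType) (x D : R) :
  (forall n, x <= D / 2 ^+ n) -> x <= 0.
Proof.
move=> xD; rewrite leNgt; apply/negP => x0.
have D0 : 0 <= D by have := le_trans (ltW x0) (xD 0%N); rewrite expr0 divr1.
have := archi_boundP (divr_ge0 D0 (ltW x0)); set n := Num.bound _ => h.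
have := xD n; rewrite leNgt ltr_pdivrMr ?exprn_gt0// => /negP; apply.
rewrite mulrC -ltr_pdivrMr//; apply: lt_le_trans h _.
by rewrite -natrX ler_nat ltnW// ltn_expl.
Qed.

Lemma uniform_limit_continuous (R : realType) (f : nat -> R -> R) (h : R -> R) D :
  (forall n, continuous (f n)) -> (forall n t, `|h t - f n t| <= D / 2 ^+ n) ->
  continuous h.
Proof.
move=> fc hf x; apply/cvgrPdist_le => e e0.
have [n Dn] : exists n, D / 2 ^+ n < e / 3.
  apply/not_existsP => H; have := @geometric_le0 R (e / 3) D.
  have H' n : e / 3 <= D / 2 ^+ n by rewrite leNgt; apply/negP; exact: H.
  by move=> /(_ H'); lra.
have /cvgrPdist_le/(_ (e / 3)) := fc n x => /(_ ltac:(lra)).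
apply: filterS => y hy.
have := hf n x; have := hf n y => h1 h2.
have -> : h x - h y = (h x - f n x) + (f n x - f n y) - (h y - f n y) by ring.
apply: (le_trans (ler_normB _ _)); have := ler_normD (h x - f n x) (f n x - f n y).
lra.
Qed.

Section picard.
Variables (R : realType) (b : R) (a G : R -> R) (L : R) (c d : R).
Local Notation mu := (@lebesgue_measure R).
Hypothesis b0 : 0 < b.
Hypothesis ai : mu.-integrable setT (EFin \o a).
Hypothesis a0 : forall x, x <= 0 -> a x = 0.
Hypothesis L0 : 0 < L.
Hypothesis GL : forall s t, `|G s - G t| <= L * `|s - t|.

Let nice (u : R -> R) := continuous u /\ exists K, forall x, `|u x| <= K.
Let force u x := a x * G (u x).
Let V u t := d - primitive (force u) t.
(** The cut-off makes [V u] integrable on the line. It starts below 0 so that the solution has a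
    two-sided derivative at 0. *)
Let Vc u := V u \_ `[-1, b].
Let U u t := c + (primitive (Vc u) t - primitive (Vc u) 0).

Lemma lipschitz_continuous (h : R -> R) K : 0 < K ->
  (forall s t, `|h s - h t| <= K * `|s - t|) -> continuous h.
Proof.
move=> K0 hK x; apply/cvgrPdist_le => e e0.
apply/nbhs_ballP; exists (e / K); first by rewrite /= divr_gt0.
move=> y; rewrite /ball/= => xy; apply: le_trans (hK _ _) _.
by rewrite mulrC -ler_pdivlMr// ltW.
Qed.

Let nice_force u : nice u -> mu.-integrable setT (EFin \o force u).
Proof.
move=> [uc [K uK]].
apply: (@integrable_mul_bounded R a (G \o u) (L * K + `|G 0|)) => //.
  move=> x; apply: continuous_comp; first exact: uc.
  exact: (lipschitz_continuous L0 GL).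
move=> x /=; rewrite -[X in `|X|](subrK (G 0)).
apply: (le_trans (ler_normD _ _)); rewrite lerD2r (le_trans (GL _ _))// subr0.
by rewrite ler_pM2l.
Qed.

Let nice_primitive f k : mu.-integrable setT (EFin \o f) ->
  nice (fun t => k + primitive f t).
Proof.
move=> fi; split.
  by move=> x; apply: cvgD; [exact: cvg_cst|exact: primitive_continuous].
exists (`|k| + \int[mu]_x `|f x|) => x; apply: (le_trans (ler_normD _ _)).
rewrite lerD2l (le_trans (normr_primitive _ _))// primitive_le_int//.
exact: integrable_norm.
Qed.

Let nice_V u : nice u -> nice (V u).
Proof.
move=> nu; have [Vcont [K VK]] := nice_primitive (- d) (nice_force nu).
rewrite (_ : V u = \- (fun t => - d + primitive (force u) t)); last first.
  by apply/funext => t; rewrite /= opprD opprK.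
split; first by move=> x; apply: cvgN; exact: Vcont.
by exists K => x; rewrite normrN.
Qed.

Let Vci u : nice u -> mu.-integrable setT (EFin \o Vc u).
Proof. by move=> /nice_V[Vcont [K VK]]; exact: integrable_patch_bounded VK. Qed.

Let nice_U u : nice u -> nice (U u).
Proof.
move=> nu; rewrite (_ : U u = (fun t => (c - primitive (Vc u) 0) + primitive (Vc u) t)).
  by apply: nice_primitive; exact: Vci.
by apply/funext => t; rewrite /U; ring.
Qed.

Let A := primitive (fun x => `|a x|).
(** Differences of iterates are measured relative to the weight [W], which makes the Picard operator
    a contraction on the whole interval. The factor [b + 1] is the length of [[-1, b]], and 4 leads
    to the contraction factor 1/2. *)
Let lam := 4 * (b + 1) * L.
Let W t := expR (lam * A t).

Let nai : mu.-integrable setT (EFin \o (fun x => `|a x|)).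
Proof. exact: integrable_norm. Qed.

Let lam0 : 0 < lam.
Proof. by apply: mulr_gt0 => //; apply: mulr_gt0 => //; rewrite addr_gt0. Qed.

Let A0 t : 0 <= A t. Proof. exact: primitive_ge0. Qed.

Let W_mono s t : s <= t -> W s <= W t.
Proof.
move=> st; rewrite ler_expR ler_pM2l//.
by apply: primitive_mono.
Qed.

Let Wmax := expR (lam * \int[mu]_x `|a x|).

Let W_ge1 t : 1 <= W t.
Proof. by rewrite -expR0 ler_expR mulr_ge0// ltW. Qed.

Let W_le t : W t <= Wmax.
Proof. by rewrite ler_expR ler_pM2l// primitive_le_int. Qed.

Let W_continuous : continuous W.
Proof.
move=> x; apply: continuous_comp; last exact: continuous_expR.
by apply: cvgM; [exact: cvg_cst|exact: primitive_continuous].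
Qed.

Let aWi : mu.-integrable setT (EFin \o (fun x => `|a x| * W x)).
Proof.
apply: (integrable_mul_bounded (K := Wmax)) => // x.
by rewrite ger0_norm ?expR_ge0.
Qed.

(** The derivative of [W] is [lam] times the integrand, and [W 0 = 1]. *)
Let primitive_aW t : lam * primitive (fun x => `|a x| * W x) t <= W t.
Proof.
have [t0|t0] := leP t 0.
  rewrite primitive_eq0 ?mulr0 ?expR_ge0// => x xt.
  by rewrite a0 ?normr0 ?mul0r//; lra.
rewrite -subr_ge0.
have /= := acd_nondecreasing (ltW t0)
  (acdD (acd_exp (acdZ lam (acd_primitive 0 t nai)))
    (acdN (acdZ lam (acd_primitive 0 t aWi)))).
rewrite (@primitive_eq0 _ _ 0); last by move=> x x0; rewrite a0// normr0.
rewrite (@primitive_eq0 _ _ 0); last by move=> x x0; rewrite a0// normr0 mul0r.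
rewrite !mulr0 expR0 oppr0 addr0 => H; apply: le_trans (H _); first exact: ler01.
apply: aeW => x _; rewrite -/(A x) -/(W x).
by rewrite [X in X - _](_ : _ = lam * (`|a x| * W x)) ?subrr//; ring.
Qed.

Let dV u w k t : 0 <= k -> nice u -> nice w -> (forall x, `|u x - w x| <= k * W x) ->
  `|V u t - V w t| <= L * k / lam * W t.
Proof.
move=> k0 nu nw uw; have fu := nice_force nu; have fw := nice_force nw.
have Lk0 : 0 <= L * k by rewrite mulr_ge0// ltW.
rewrite (_ : _ - _ = primitive (force w) t - primitive (force u) t); last first.
  by rewrite /V; ring.
rewrite -primitive_sub//.
apply: (le_trans (normr_primitive _ _)).
  by have := integrableB measurableT fw fu; apply: eq_integrable.
rewrite -(ler_pM2l lam0) [leRHS](_ : _ = L * k * W t); last first.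
  by rewrite mulrCA mulrA divfK ?gt_eqF.
apply: (@le_trans _ _ (lam * (L * k * primitive (fun x => `|a x| * W x) t))).
  rewrite ler_pM2l// -primitiveZl//.
  apply: le_primitive => [||x xt].
  - apply: integrable_norm.
    by have := integrableB measurableT fw fu; apply: eq_integrable.
  - exact: integrable_scale.
  rewrite /force -mulrBr normrM [leRHS](_ : _ = `|a x| * (L * (k * W x))); last ring.
  by rewrite ler_wpM2l// (le_trans (GL _ _))// ler_pM2l// distrC.
by rewrite mulrCA ler_wpM2l.
Qed.

(** Integrating the bound [dV] over a length of at most [b + 1] gives [k / 4 * W]; this is used once
    at [t] and once at the base point 0. *)
Let dU u w k t : 0 <= k -> nice u -> nice w -> (forall x, `|u x - w x| <= k * W x) ->
  `|U u t - U w t| <= k / 2 * W t.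
Proof.
move=> k0 nu nw uw.
have Vi : mu.-integrable setT (EFin \o (fun x => Vc u x - Vc w x)).
  have := integrableB measurableT (Vci nu) (Vci nw); by apply: eq_integrable.
have Lkl : 0 <= L * k / lam.
  by apply: divr_ge0; [apply: mulr_ge0 => //; exact: ltW|exact: ltW].
have H s : `|primitive (Vc u) s - primitive (Vc w) s| <= k / 4 * W s.
  rewrite -primitive_sub ?Vci//; apply: (le_trans (normr_primitive _ Vi)).
  apply: (@le_trans _ _ (primitive (cst (L * k / lam * W s) \_ `[-1, b]) s)).
    apply: le_primitive => [||x xs].
    - exact: integrable_norm.
    - apply: (@integrable_patch_bounded _ _ _ _ `|L * k / lam * W s|) => //.
      by move=> x; exact: cvg_cst.
    rewrite /Vc !patchE; case: ifP => _; last by rewrite subrr normr0.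
    by apply: le_trans (dV _ k0 nu nw uw) _; rewrite ler_wpM2l ?W_mono.
  apply: (le_trans (primitive_le_int _ _ _)).
  - apply: (@integrable_patch_bounded _ _ _ _ `|L * k / lam * W s|) => //.
    by move=> x; exact: cvg_cst.
  - by move=> x; rewrite patchE; case: ifP => // _; rewrite mulr_ge0// expR_ge0.
  rewrite -Rintegral_mkcond Rintegral_cst_itv; last by have := b0; lra.
  rewrite opprK [leLHS](_ : _ = k / 4 * W s)//.
  move: (W s) => Ws; rewrite /lam.
  have b1 : b + 1 != 0 by rewrite gt_eqF// addr_gt0.
  have L1 : L != 0 by rewrite gt_eqF.
  by field; rewrite b1 L1.
have -> : U u t - U w t = (primitive (Vc u) t - primitive (Vc w) t) -
    (primitive (Vc u) 0 - primitive (Vc w) 0).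
  rewrite /U; move: (primitive (Vc u) t) (primitive (Vc w) t).
  by move: (primitive (Vc u) 0) (primitive (Vc w) 0) => p1 p2 p3 p4; ring.
have W0t : k / 4 * W 0 <= k / 4 * W t.
  apply: ler_wpM2l; first exact: divr_ge0.
  have [|/ltW] := leP 0 t; first exact: W_mono.
  by move=> t0; rewrite /W/A primitive_eq0 ?mulr0 ?expR0 ?W_ge1// => x x0; rewrite a0 ?normr0.
apply: (le_trans (ler_normB _ _)); apply: (le_trans (lerD (H t) (H 0))).
apply: (le_trans (lerD (lexx _) W0t)); rewrite -mulrDl -mulrDr.
rewrite (_ : 4^-1 + 4^-1 = 2^-1 :> R)//; by field.
Qed.

(** The iterates from 0 converge geometrically, and the contraction estimate makes the limit a fixed
    point. Since [V h] is continuous, [u] is differentiable everywhere inside the interval. *)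
Lemma ode_solution : exists u v : R -> R,
  [/\ v = (fun t => d - primitive (fun x => a x * G (u x)) t),
      mu.-integrable setT (EFin \o (fun x => a x * G (u x))),
      continuous u,
      (forall t, -1 < t < b -> is_derive t (1 : R) u (v t)) & u 0 = c].
Proof.
pose f n := iter n U (cst 0).
have nf n : nice (f n).
  elim: n => [|n ih]; last exact: nice_U.
  by split; [move=> x; exact: cvg_cst|exists 0 => x; rewrite normr0].
have [_ [K f1K]] := nf 1%N.
have K0 : 0 <= K by apply: le_trans (f1K 0).
have step n t : `|f n.+1 t - f n t| <= K / 2 ^+ n * W t.
  elim: n t => [|n ih] t.
    rewrite expr0 divr1 subr0; apply: le_trans (f1K t) _.
    by apply: ler_peMr => //; exact: W_ge1.
  have -> : K / 2 ^+ n.+1 = K / 2 ^+ n / 2 by rewrite exprS invfM mulrCA mulrC.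
  by apply: (dU t _ (nf n.+1) (nf n) ih); apply: divr_ge0 => //; exact: exprn_ge0.
have [h hf] := @geometric_fun_limit R R f (K * Wmax) (fun n t => le_trans (step n t)
  (le_trans (ler_wpM2l (divr_ge0 K0 (exprn_ge0 n (ler0n R 2))) (W_le t))
  (ltac:(by rewrite mulrAC)))).
set C := 2 * (K * Wmax) in hf.
have C0 : 0 <= C by do 2 apply: mulr_ge0 => //; exact: expR_ge0.
have nh : nice h.
  split; first by apply: uniform_limit_continuous hf => n; exact: (nf n).1.
  exists C => x; have := hf 0%N x; rewrite expr0 divr1 /f/= subr0; exact.
have Uh t : U h t = h t.
  apply/eqP; rewrite -subr_eq0 -normr_le0.
  apply: (@geometric_le0 _ _ (C / 2 * Wmax + C / 2)) => n.
  have h1 := @dU h (f n) (C / 2 ^+ n) t (divr_ge0 C0 (exprn_ge0 _ (ler0n _ _))) nh (nf n).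
  have {}h1 : `|U h t - U (f n) t| <= C / 2 ^+ n / 2 * Wmax.
    apply: le_trans (h1 _) _.
      move=> x; apply: le_trans (hf n x) _; apply: ler_peMr; last exact: W_ge1.
      by apply: divr_ge0 => //; exact: exprn_ge0.
    by apply: ler_wpM2l => //; do 2 apply: divr_ge0 => //; exact: exprn_ge0.
  have h2 := hf n.+1 t; rewrite exprS in h2.
  have -> : U h t - h t = (U h t - U (f n) t) - (h t - f n.+1 t).
    by rewrite /f iterS -/(f n); move: (U h t) (U (f n) t) => p1 p2; ring.
  apply: (le_trans (ler_normB _ _)); apply: (le_trans (lerD h1 h2)).
  rewrite le_eqVlt; apply/orP; left; apply/eqP.
  by move: Wmax C {h1 h2 hf C0} => w1 w2; field; rewrite expf_neq0.
exists h, (V h); split => //.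
- exact: nice_force.
- by have [] := nh.
- move=> t /andP[t1 tb].
  have Vct : {for t, continuous (Vc h)}.
    have tin : t \in `]-1, b[ by rewrite in_itv/= t1.
    have b1 : -1 < b by lra.
    have vht : {for t, continuous (V h)} by exact: (nice_V nh).1.
    rewrite /prop_for/continuous_at {2}/Vc patchE ifT; last first.
      by rewrite inE/= in_itv/= !ltW.
    apply: cvg_trans vht; apply: near_eq_cvg.
    have : nbhs t `]-1, b[%classic by apply: near_in_itvoo.
    apply: filterS => x /= xb; rewrite /Vc patchE ifT// inE/=.
    exact: subset_itv_oo_cc xb.
  have Vcit : mu.-integrable `]-oo, t + 1]%classic (EFin \o Vc h).
    by apply: integrableS (Vci nh).
  have [dP P'] := @continuous_FTC1 R (Vc h) -oo%O t (t + 1) ltac:(lra) Vcit (ltNyr _) Vct.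
  have Pd : is_derive t (1 : R) (primitive (Vc h)) (V h t).
    have -> : V h t = derive1 (primitive (Vc h)) t.
      rewrite (_ : derive1 (primitive (Vc h)) t = Vc h t); last exact: P'.
      by rewrite /Vc patchE ifT// inE/= in_itv/= !ltW.
    by rewrite derive1E; exact/derivableP.
  apply/is_derive1P => e e0; have /is_derive1P/(_ e e0)[r r0 Hr] := Pd.
  exists r => // y yt; have := Hr y yt.
  rewrite -(Uh y) -(Uh t) /U.
  move: (primitive (Vc h) y) (primitive (Vc h) t) (primitive (Vc h) 0) => p1 p2 p3.
  by have -> : c + (p1 - p3) - (c + (p2 - p3)) = p1 - p2 by ring.
by rewrite -Uh /U subrr addr0.
Qed.

End picard.

(** * Zeros of planar maps *)

(* The Sperner labels are Some true, Some false and None; only the changes between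
   the first two are counted. *)
Definition label_change (p q : option bool) : bool :=
  if p is Some b then if q is Some c then b (+) c else false else false.

(** Around a cell without all three labels the number of counted changes is even. As no change
    occurs on the bottom and top rows, the parity along a column is the same for all columns; it is
    odd for the first and even for the last. *)
Lemma sperner_grid (N M : nat) (l : nat -> nat -> option bool) :
  (forall i, (i <= N)%N -> l i 0%N = Some true) ->
  (forall i, (i <= N)%N -> l i M = Some true) ->
  (forall j, (j <= M)%N -> l N j = Some true) ->
  \big[addb/false]_(j < M) label_change (l 0%N j) (l 0%N j.+1) ->
  exists i j, [/\ (i < N)%N, (j < M)%N &
    let s := [:: l i j; l i.+1 j; l i.+1 j.+1; l i j.+1] in
    [&& Some true \in s, Some false \in s & None \in s]].
Proof.
move=> lb lt lr; apply: contraPP => /forallNP nsq.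
have sq i j : (i < N)%N -> (j < M)%N ->
    label_change (l i j) (l i.+1 j) (+) label_change (l i.+1 j) (l i.+1 j.+1) =
    label_change (l i j.+1) (l i.+1 j.+1) (+) label_change (l i j) (l i j.+1).
  move=> iN jM; have /forallNP/(_ j) := nsq i.
  move: (l i j) (l i.+1 j) (l i.+1 j.+1) (l i j.+1) => p q r s H.
  have {H} : ~~ (let t := [:: p; q; r; s] in
    [&& Some true \in t, Some false \in t & None \in t]).
    by apply/negP => H'; apply: H; split.
  by move: p q r s => [[]|] [[]|] [[]|] [[]|].
pose V i m := \big[addb/false]_(j < m) label_change (l i j) (l i j.+1).
have strip i m : (i < N)%N -> (m <= M)%N ->
    V i m (+) label_change (l i m) (l i.+1 m) =
    label_change (l i 0%N) (l i.+1 0%N) (+) V i.+1 m.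
  move=> iN; elim: m => [_|m ih mM]; first by rewrite /V !big_ord0 addbF.
  rewrite /V !big_ord_recr/= -/(V i m) -/(V i.+1 m).
  have := sq i m iN mM; have := ih (ltnW mM).
  move: (V i m) (V i.+1 m) (label_change _ _) (label_change _ _) (label_change _ _).
  move: (label_change _ _) (label_change _ _) => a b c d e f g.
  by move: a b c d e f g; do 7 case.
have VE i : (i <= N)%N -> V i M = V 0%N M.
  elim: i => // i ih iN; rewrite -ih ?(ltnW iN)//.
  have := strip i M iN (leqnn _).
  by rewrite !lb ?lt ?(ltnW iN)//= addbF.
rewrite -/(V 0%N M) -(VE N)//; apply/negP; rewrite /V big1// => j _.
by rewrite !lr ?(ltnW (ltn_ord j)).
Qed.

Section planar_zero.
Variables (R : realType) (F1 F2 : R -> R -> R) (K x0 x1 y0 y1 ym k : R).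
Hypothesis K0 : 0 <= K.
Hypothesis F1K : forall x y x' y',
  `|F1 x y - F1 x' y'| <= K * (`|x - x'| + `|y - y'|).
Hypothesis F2K : forall x y x' y',
  `|F2 x y - F2 x' y'| <= K * (`|x - x'| + `|y - y'|).
Hypothesis x01 : x0 < x1.
Hypothesis y0m : y0 < ym.
Hypothesis ym1 : ym < y1.
Hypothesis F1right : forall y, y0 <= y <= y1 -> F1 x1 y < 0.
Hypothesis F1bot : forall x, x0 <= x <= x1 -> F1 x y0 < 0.
Hypothesis F1top : forall x, x0 <= x <= x1 -> F1 x y1 < 0.
Hypothesis F1m : 0 < F1 x0 ym.
Hypothesis k0 : 0 < k.
Hypothesis F2low : forall y, y0 <= y <= ym -> F1 x0 y = 0 -> k <= F2 x0 y.
Hypothesis F2high : forall y, ym <= y <= y1 -> F1 x0 y = 0 -> F2 x0 y <= - k.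

Let F1_IVT y y' : y <= y' -> F1 x0 y < 0 <= F1 x0 y' \/ F1 x0 y' < 0 <= F1 x0 y ->
  exists2 z, y <= z <= y' & F1 x0 z = 0.
Proof.
move=> yy' h; have [||z] := @IVT R (F1 x0) y y' 0 yy'.
- apply: continuous_subspaceT; apply: (@lipschitz_continuous _ _ (K + 1)).
    by rewrite ltr_wpDl.
  move=> s t; apply: le_trans (F1K _ _ _ _) _; rewrite subrr normr0 add0r.
  by rewrite ler_wpM2r// lerDl.
- by rewrite ge_min le_max; case: h => /andP[/ltW-> ->]; rewrite ?orbT.
- by rewrite in_itv/= => zyy' F1z; exists z.
Qed.

(** A sign change of [F1] encloses a zero, where [F2 >= k], and [F2] varies by less than [k]. Below
    [ym] each sign change thus joins [Some true] to [Some false] and is counted; by [high_neg],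
    above [ym] it joins [Some true] to [None] and is not. *)
Let low_pos y y' : y0 <= y -> y <= y' -> y' <= ym -> K * (y' - y) < k ->
  F1 x0 y < 0 <= F1 x0 y' \/ F1 x0 y' < 0 <= F1 x0 y ->
  0 < F2 x0 y /\ 0 < F2 x0 y'.
Proof.
move=> y0y yy' ym' Kk sg; have [z /andP[zy zy'] Fz] := F1_IVT yy' sg.
have kz : k <= F2 x0 z by apply: F2low => //; rewrite (le_trans y0y)// (le_trans zy').
have h w : y <= w <= y' -> 0 < F2 x0 w.
  move=> /andP[w1 w2]; have := F2K x0 z x0 w; rewrite subrr normr0 add0r ler_distl.
  have : K * `|z - w| <= K * (y' - y).
    by apply: ler_wpM2l => //; rewrite ler_distl; lra.
  lra.
by split; apply: h; rewrite lexx ?yy'.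
Qed.

Let high_neg y y' : ym <= y -> y <= y' -> y' <= y1 -> K * (y' - y) < k ->
  F1 x0 y < 0 <= F1 x0 y' \/ F1 x0 y' < 0 <= F1 x0 y ->
  F2 x0 y < 0 /\ F2 x0 y' < 0.
Proof.
move=> y0y yy' ym' Kk sg; have [z /andP[zy zy'] Fz] := F1_IVT yy' sg.
have kz : F2 x0 z <= - k by apply: F2high => //; rewrite (le_trans y0y)// (le_trans zy').
have h w : y <= w <= y' -> F2 x0 w < 0.
  move=> /andP[w1 w2]; have := F2K x0 z x0 w; rewrite subrr normr0 add0r ler_distl.
  have : K * `|z - w| <= K * (y' - y).
    by apply: ler_wpM2l => //; rewrite ler_distl; lra.
  lra.
by split; apply: h; rewrite lexx ?yy'.
Qed.

(** Treats the grid step across [ym]: as [F1] is positive at [ym], the zero can be found in the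
    upper part. *)
Let straddle y y' : y <= ym -> ym <= y' -> y' <= y1 -> K * (y' - y) < k ->
  F1 x0 y' < 0 -> F2 x0 y < 0.
Proof.
move=> yym ymy' y'1 Kk Fy'.
have [|z /andP[zy zy'] Fz] := F1_IVT ymy'; first by right; rewrite Fy' ltW// F1m.
have kz : F2 x0 z <= - k by apply: F2high => //; rewrite zy (le_trans zy').
have := F2K x0 z x0 y; rewrite subrr normr0 add0r ler_distl.
have : K * `|z - y| <= K * (y' - y).
  by apply: ler_wpM2l => //; rewrite ler_distl; lra.
lra.
Qed.

(** In a cell with all three labels [F1] changes sign between [Some true] and [Some false], and [F2]
    between [Some false] and [None]. The Lipschitz bounds then make both small at a corner. *)
Let near_zero (N : nat) : (0 < N)%N ->
  let h := ((x1 - x0) + (y1 - y0)) / N%:R in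
  K * h < k -> K * h < F1 x0 ym ->
  exists x y, [/\ x0 <= x <= x1, y0 <= y <= y1 & `|F1 x y| + `|F2 x y| <= 2 * (K * h)].
Proof.
have x01' := x01; have y0m' := y0m; have ym1' := ym1; have K0' := K0.
move=> N0 h hk hm.
have N0' : 0 < N%:R :> R by rewrite ltr0n.
pose hx := (x1 - x0) / N%:R; pose hy := (y1 - y0) / N%:R.
have hE : h = hx + hy by rewrite /h mulrDl.
have hx0 : 0 <= hx by rewrite divr_ge0 ?ler0n//; lra.
have hy0 : 0 <= hy by rewrite divr_ge0 ?ler0n//; lra.
pose X (i : nat) := x0 + i%:R * hx; pose Y (j : nat) := y0 + j%:R * hy.
have X0 : X 0%N = x0 by rewrite /X mul0r addr0.
have Y0 : Y 0%N = y0 by rewrite /Y mul0r addr0.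
have XN : X N = x1 by rewrite /X mulrC divfK ?gt_eqF//; ring.
have YN : Y N = y1 by rewrite /Y mulrC divfK ?gt_eqF//; ring.
have XS i : X i.+1 = X i + hx by rewrite /X -natr1; ring.
have YS i : Y i.+1 = Y i + hy by rewrite /Y -natr1; ring.
have Xin i : (i <= N)%N -> x0 <= X i <= x1.
  move=> iN; rewrite -XN /X lerDl mulr_ge0//= lerD2l ler_wpM2r//.
  by rewrite ler_nat.
have Yin i : (i <= N)%N -> y0 <= Y i <= y1.
  move=> iN; rewrite -YN /Y lerDl mulr_ge0//= lerD2l ler_wpM2r//.
  by rewrite ler_nat.
pose l i j := if F1 (X i) (Y j) < 0 then Some true
  else if 0 <= F2 (X i) (Y j) then Some false else None.
have KhyE : K * hy <= K * h by rewrite ler_wpM2l// hE; lra.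
have Kk : K * hy < k by exact: le_lt_trans KhyE hk.
(* Up to [ym] the parity on the left side records the sign of [F1]; at [ym] this sign is positive,
   and no later change is counted, so that the total is odd. *)
have left j : (j <= N)%N -> \big[addb/false]_(i < j) label_change (l 0%N i) (l 0%N i.+1) =
    if Y j <= ym then ~~ (F1 x0 (Y j) < 0) else true.
  elim: j => [_|j ih jN].
    by rewrite big_ord0 Y0 ltW// F1bot// lexx ltW.
  rewrite big_ord_recr/= ih ?(ltnW jN)//.
  have jj : Y j <= Y j.+1 by rewrite YS; lra.
  have /andP[Yj0 Yj1] := Yin j (ltnW jN); have /andP[YSj0 YSj1] := Yin j.+1 jN.
  rewrite /l X0.
  have Kj : K * (Y j.+1 - Y j) < k by rewrite YS [Y j + _]addrC addrK.
  have [Sm|mS] := leP (Y j.+1) ym.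
    rewrite (le_trans jj Sm).
    have H := low_pos Yj0 jj Sm Kj.
    have [Fj|Fj] := ltP (F1 x0 (Y j)) 0; have [FS|FS] := ltP (F1 x0 (Y j.+1)) 0 => //=.
    + by have [|_ /ltW->] := H; first by left; rewrite Fj FS.
    + by have [|/ltW-> _] := H; first by right; rewrite Fj FS.
    + by do 2 case: ifP.
  have [jm|mj] := leP (Y j) ym.
    have Fj : 0 <= F1 x0 (Y j).
      have := F1K x0 ym x0 (Y j); rewrite subrr normr0 add0r.
      rewrite [`|ym - _|]ger0_norm ?subr_ge0// ler_distl => /andP[_ h1].
      have h2 : K * (ym - Y j) <= K * h.
        by apply: le_trans KhyE; apply: ler_wpM2l => //; rewrite lerBlDl -YS ltW.
      by move: h1 h2 hm; move: (F1 _ _) (F1 _ _) (K * _) (K * _) => *; lra.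
    rewrite ltNge Fj/=.
    have [FS|FS] := ltP (F1 x0 (Y j.+1)) 0; last by do 2 case: ifP.
    by have := straddle jm (ltW mS) YSj1 Kj FS; rewrite ltNge => /negbTE->.
  have H := high_neg (ltW mj) jj YSj1 Kj.
  have [Fj|Fj] := ltP (F1 x0 (Y j)) 0; have [FS|FS] := ltP (F1 x0 (Y j.+1)) 0 => //=.
  + have [|_] := H; first by left; rewrite Fj FS.
    by rewrite ltNge => /negbTE->.
  + have [|+ _] := H; first by right; rewrite Fj FS.
    by rewrite ltNge => /negbTE->.
  + by do 2 case: ifP.
have [||||i [j [iN jN /and3P[s1 s2 s3]]]] := @sperner_grid N N l.
- by move=> i iN; rewrite /l Y0 F1bot// Xin.
- by move=> i iN; rewrite /l YN F1top// Xin.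
- by move=> i iN; rewrite /l XN F1right// Yin.
- by rewrite left// YN leNgt ym1.
exists (X i), (Y j); split; [exact: Xin (ltnW iN)|exact: Yin (ltnW jN)|].
have corner b : b \in [:: l i j; l i.+1 j; l i.+1 j.+1; l i j.+1] ->
    exists x y, [/\ `|F1 (X i) (Y j) - F1 x y| <= K * h,
      `|F2 (X i) (Y j) - F2 x y| <= K * h &
      b = if F1 x y < 0 then Some true else if 0 <= F2 x y then Some false else None].
  have D x y : x = X i \/ x = X i.+1 -> y = Y j \/ y = Y j.+1 ->
      `|X i - x| + `|Y j - y| <= h.
    move=> hx' hy'; rewrite hE lerD//.
      case: hx' => ->; first by rewrite subrr normr0.
      by rewrite XS opprD addrA subrr add0r normrN ger0_norm.
    case: hy' => ->; first by rewrite subrr normr0.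
    by rewrite YS opprD addrA subrr add0r normrN ger0_norm.
  have E x y : x = X i \/ x = X i.+1 -> y = Y j \/ y = Y j.+1 ->
     `|F1 (X i) (Y j) - F1 x y| <= K * h /\ `|F2 (X i) (Y j) - F2 x y| <= K * h.
    move=> hx' hy'; split; (apply: le_trans (F1K _ _ _ _) _ || apply: le_trans (F2K _ _ _ _) _);
      by rewrite ler_wpM2l// D.
  rewrite !inE => /or4P[]/eqP->.
  - by exists (X i), (Y j); have [] := E (X i) (Y j) (or_introl erefl) (or_introl erefl); split.
  - by exists (X i.+1), (Y j); have [] := E (X i.+1) (Y j) (or_intror erefl) (or_introl erefl); split.
  - by exists (X i.+1), (Y j.+1); have [] := E (X i.+1) (Y j.+1) (or_intror erefl) (or_intror erefl); split.
  - by exists (X i), (Y j.+1); have [] := E (X i) (Y j.+1) (or_introl erefl) (or_intror erefl); split.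
have [x [y [a1 a2]]] := corner _ s1.
case: ltP => [a3 _|]; last by case: ifP.
have [x' [y' [b1 b2]]] := corner _ s2.
case: ltP => // b3; case: leP => // b4 _.
have [x'' [y'' [c1 c2]]] := corner _ s3.
case: ltP => // c3; case: leP => // c4 _.
move: a1 b1 b2 c2; rewrite !ler_distl => a1 b1 b2 c2.
have {}a1 : `|F1 (X i) (Y j)| <= K * h.
  rewrite ler_norml; move: a1 b1 a3 b3; clear.
  by move: (F1 _ _) (F1 _ _) (F1 _ _) (K * h) => *; lra.
have {}b2 : `|F2 (X i) (Y j)| <= K * h.
  rewrite ler_norml; move: b2 c2 b4 c4; clear.
  by move: (F2 _ _) (F2 _ _) (F2 _ _) (K * h) => *; lra.
by rewrite mulrDl !mul1r lerD.
Qed.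

(** The continuous function [|F1| + |F2|] attains its minimum on the rectangle, and [near_zero] on
    finer and finer grids forces this minimum to be 0. *)
Lemma planar_zero :
  exists x y, [/\ x0 <= x <= x1, y0 <= y <= y1, F1 x y = 0 & F2 x y = 0].
Proof.
pose f (p : R * R) := `|F1 p.1 p.2| + `|F2 p.1 p.2|.
pose D : set (R * R) := `[x0, x1]%classic `*` `[y0, y1]%classic.
have D0 : D !=set0.
  by exists (x0, y0); split; rewrite /= in_itv/= lexx/= ltW// (lt_trans y0m).
have cD : compact D by apply: compact_setX; exact: segment_compact.
have cf : continuous f.
  have cF (F : R -> R -> R) : (forall x y x' y',
      `|F x y - F x' y'| <= K * (`|x - x'| + `|y - y'|)) ->
      continuous (fun p : R * R => `|F p.1 p.2|).
    move=> FK p; apply: cvg_norm; apply/cvgrPdist_le => e e0.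
    have r0 : 0 < e / (2 * (K + 1)) by rewrite divr_gt0// mulr_gt0// ltr_wpDl.
    exists (ball p.1 (e / (2 * (K + 1))), ball p.2 (e / (2 * (K + 1)))) => [|q [q1 q2]].
      by split; exact: nbhsx_ballx.
    apply: le_trans (FK _ _ _ _) _.
    apply: (@le_trans _ _ ((K + 1) * (e / (2 * (K + 1)) + e / (2 * (K + 1))))).
      by apply: ler_pM; [exact: K0|exact: addr_ge0|rewrite lerDl|rewrite lerD// ltW].
    rewrite le_eqVlt; apply/orP; left; apply/eqP; field.
    by rewrite gt_eqF// ltr_wpDl.
  by move=> p; apply: cvgD; apply: cF.
have [p pD pmin] := compact_EVT_min D0 cD (continuous_subspaceT cf).
have f0 : f p <= 0.
  rewrite leNgt; apply/negP => fp0.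
  pose S := (x1 - x0) + (y1 - y0).
  have S0 : 0 < S by apply: addr_gt0; rewrite subr_gt0// (lt_trans y0m).
  (* A mesh with [K h < r] satisfies the two conditions of [near_zero] and yields a value below the
     minimum [f p]. *)
  pose r := Num.min (Num.min k (F1 x0 ym)) (f p / 2).
  have r0 : 0 < r.
    by rewrite /r !lt_min k0 F1m divr_gt0.
  have := archi_boundP (divr_ge0 (mulr_ge0 K0 (ltW S0)) (ltW r0)).
  set N := Num.bound _ => hN.
  have NS : 0 < N.+1%:R :> R by rewrite ltr0n.
  have KS : K * (S / N.+1%:R) < r.
    rewrite mulrA ltr_pdivrMr// -ltr_pdivrMl//; apply: (@lt_le_trans _ _ N%:R).
      by rewrite mulrC.
    by rewrite ler_nat.
  have := KS; rewrite /r !lt_min => /andP[/andP[h1 h2] h3].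
  have [x [y [xx yy xy]]] := near_zero (ltn0Sn N) h1 h2.
  have := pmin (x, y); rewrite inE => /(_ ltac:(by split; rewrite /= in_itv)).
  rewrite {2}/f/= => h4; have := le_trans h4 xy.
  by rewrite leNgt mulrC -ltr_pdivlMr// h3.
move: f0; rewrite /f => f0.
have := pD; rewrite inE => -[]; rewrite /= !in_itv/= => px py.
exists p.1, p.2; split => //; apply/eqP; rewrite -normr_le0.
  by have := normr_ge0 (F2 p.1 p.2); lra.
by have := normr_ge0 (F1 p.1 p.2); lra.
Qed.

End planar_zero.

(** * The truncated equation *)

Section trajectory.
Variables (R : realType) (T : R) (a G : R -> R) (L : R).
Local Notation mu := (@lebesgue_measure R).
Hypothesis T0 : 0 < T.
Hypothesis ai : mu.-integrable setT (EFin \o a).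
Hypothesis a0 : forall x, x <= 0 -> a x = 0.
Hypothesis L0 : 0 < L.
Hypothesis GL : forall s t, `|G s - G t| <= L * `|s - t|.
Hypothesis G0 : forall s, s <= 0 -> G s = 0.

(** The equation [u'' = - a G(u)] in integrated form. The interval exceeds [[0, T]] on both sides,
    so that ordinary derivatives are available at 0 and [T]. *)
Definition trajectory (u v : R -> R) := [/\
  v = (fun t => v 0 - primitive (fun x => a x * G (u x)) t),
  mu.-integrable setT (EFin \o (fun x => a x * G (u x))),
  continuous u &
  forall t, -1 < t < T + 1 -> is_derive t (1 : R) u (v t)].

Lemma trajectory_exists c d : exists uv : (R -> R) * (R -> R),
  [/\ trajectory uv.1 uv.2, uv.1 0 = c & uv.2 0 = d].
Proof.
have T1 : 0 < T + 1 by rewrite addr_gt0.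
have [u [v [vE i uc uv u0]]] := ode_solution c d T1 ai a0 L0 GL.
have v0 : v 0 = d by rewrite vE primitive_eq0 ?subr0// => x /a0->; rewrite mul0r.
by exists (u, v); split => //; split => //=; rewrite v0.
Qed.

Lemma trajectory0 : trajectory (cst 0) (cst 0).
Proof.
have E : (fun x => a x * G ((cst 0 : R -> R) x)) = cst 0.
  by apply/funext => x; rewrite /= G0// mulr0.
split.
- by apply/funext => t; rewrite E primitive_eq0// subrr.
- by rewrite E; apply: integrable0.
- by move=> x; exact: cvg_cst.
- by move=> t _; exact: is_derive_cst.
Qed.

Let A := primitive (fun x => `|a x|).
Let nai : mu.-integrable setT (EFin \o (fun x => `|a x|)).
Proof. exact: integrable_norm. Qed.

Section one_trajectory.
Variables u v : R -> R.
Hypothesis uv : trajectory u v.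

Lemma trajectory_vE t : v t = v 0 - primitive (fun x => a x * G (u x)) t.
Proof. by have [E _ _ _] := uv; exact: (congr1 (fun f => f t) E). Qed.

Lemma trajectory_acdv s t : acd s t v (fun x => - (a x * G (u x))).
Proof.
have [E i _ _] := uv.
have := acdD (@acd_cst R s t (v 0)) (acdN (acd_primitive s t i)).
rewrite [X in acd _ _ X _](_ : _ = v); last first.
  by apply/funext => x; rewrite [RHS]trajectory_vE.
by move=> H; apply: (acd_ae H); apply: aeW => x _ /=; rewrite add0r.
Qed.

Lemma trajectory_acdu s t : 0 <= s -> t <= T -> acd s t u v.
Proof.
move=> s0 tT; have [_ _ uc ud] := uv.
have [K vK] := ac_bounded (trajectory_acdv s t).1.
apply: (@acd_C1 _ _ _ _ _ K).
- exact: continuous_subspaceT.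
- by move=> x; rewrite in_itv/= => xst; apply: ud; lra.
- by move=> x; rewrite in_itv/= => xst; apply: vK; lra.
Qed.

Lemma trajectory_vB s t m : s <= t ->
  (forall x, s <= x <= t -> `|G (u x)| <= m) ->
  `|v t - v s| <= m * (A t - A s).
Proof.
move=> st Gm; have [_ i _ _] := uv.
have -> : v t - v s = - (primitive (fun x => a x * G (u x)) t -
    primitive (fun x => a x * G (u x)) s).
  by rewrite (trajectory_vE t) (trajectory_vE s); ring.
rewrite normrN primitiveB//.
have mst : measurable (`]s, t]%classic : set R) by exact: measurable_itv.
have iS f : mu.-integrable setT (EFin \o f) -> mu.-integrable `]s, t]%classic (EFin \o f).
  by move=> fi; exact: integrableS fi.
apply: le_trans (le_normr_Rintegral _ _) _ => //; first exact: iS.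
rewrite /A primitiveB// -RintegralZl//; last exact: iS.
apply: le_Rintegral => //.
- by apply: iS; exact: integrable_norm.
- by apply: iS; exact: integrable_scale.
- move=> x; rewrite /= in_itv/= => /andP[sx xt].
  by rewrite normrM mulrC ler_wpM2r// Gm// ltW.
Qed.

Lemma trajectory_MVT s t : 0 <= s -> s < t -> t <= T ->
  exists2 x, s < x < t & u t - u s = v x * (t - s).
Proof.
move=> s0 st tT; have [_ _ uc ud] := uv.
have [||x xst ->] := @MVT R u v s t st; last by exists x.
- by move=> x; rewrite in_itv/= => xst; apply: ud; lra.
- exact: continuous_subspaceT.
Qed.

End one_trajectory.

Let B : R := expR (T + L * A T).

(** Gronwall's inequality for the difference, with [l = L |a|]; the constant [B] serves for all [s]
    and [t]. *)
Lemma trajectory_dist2 u v u' v' s t : trajectory u v -> trajectory u' v' ->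
  0 <= s -> s <= t -> t <= T ->
  (u t - u' t) ^+ 2 + (v t - v' t) ^+ 2 <=
    ((u s - u' s) ^+ 2 + (v s - v' s) ^+ 2) * B /\
  (u s - u' s) ^+ 2 + (v s - v' s) ^+ 2 <=
    ((u t - u' t) ^+ 2 + (v t - v' t) ^+ 2) * B.
Proof.
move=> uv uv' s0 st tT.
have pq := acdD (trajectory_acdu uv s0 tT) (acdN (trajectory_acdu uv' s0 tT)).
have qq := acdD (trajectory_acdv uv s t) (acdN (trajectory_acdv uv' s t)).
have li : mu.-integrable setT (EFin \o (fun x => L * `|a x|)).
  exact: integrable_scale.
have lge0 x : 0 <= L * `|a x| by apply: mulr_ge0 => //; exact: ltW.
have [|h1 h2] := gronwall_system st li lge0 pq qq.
  apply: aeW => x _ /=.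
  rewrite -opprD normrN -mulrBr normrM [L * _]mulrC -mulrA.
  by apply: ler_wpM2l => //; exact: GL.
have BB : expR (t - s + (primitive (fun x => L * `|a x|) t -
    primitive (fun x => L * `|a x|) s)) <= B.
  rewrite ler_expR lerD//; first lra.
  rewrite !primitiveZl// -mulrBr ler_pM2l//.
  have : 0 <= primitive (fun x => `|a x|) s by exact: primitive_ge0.
  have : primitive (fun x => `|a x|) t <= A T by exact: primitive_mono.
  lra.
have sq (x y : R) : 0 <= x ^+ 2 + y ^+ 2 by rewrite addr_ge0 ?sqr_ge0.
by split; [apply: le_trans h1 _|apply: le_trans h2 _]; rewrite ler_wpM2l// sq.
Qed.

(** Passes from Euclidean to absolute norms; the square root of [2 K] is replaced by the cruder
    [2 K]. *)
Let sum_sqrt (K x y z w : R) : 1 <= K -> x ^+ 2 + y ^+ 2 <= (z ^+ 2 + w ^+ 2) * K ->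
  `|x| + `|y| <= 2 * K * (`|z| + `|w|).
Proof.
move=> K1 H; rewrite -(@ler_pXn2r _ 2)// ?nnegrE ?addr_ge0//; last first.
  by rewrite !mulr_ge0 ?addr_ge0//; lra.
apply: (@le_trans _ _ (2 * (x ^+ 2 + y ^+ 2))).
  rewrite -subr_ge0 -(real_normK (num_real x)) -(real_normK (num_real y)).
  rewrite (_ : _ - _ = (`|x| - `|y|) ^+ 2) ?sqr_ge0//; by ring.
apply: (@le_trans _ _ (2 * ((z ^+ 2 + w ^+ 2) * K))); first by rewrite ler_pM2l.
apply: (@le_trans _ _ (2 * K * (`|z| + `|w|) ^+ 2)).
  rewrite -[leRHS]mulrA ler_pM2l// mulrC ler_wpM2l//; first lra.
  rewrite sqrrD !real_normK ?num_real// addrAC lerDl.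
  by rewrite mulrn_wge0// mulr_ge0.
rewrite [X in _ <= X]exprMn ler_wpM2r ?sqr_ge0//.
rewrite -[X in X <= _]mulr1 expr2 ler_wpM2l//; lra.
Qed.

Let B1 : 1 <= B.
Proof.
rewrite -expR0 ler_expR addr_ge0 ?(ltW T0)// mulr_ge0 ?(ltW L0)//.
exact: primitive_ge0.
Qed.

Definition growth_constant := 2 * B.
Local Notation K := growth_constant.

Lemma growth_constant_ge2 : 2 <= K.
Proof. by rewrite /K; have := B1; lra. Qed.

Lemma trajectory_lipschitz u v u' v' t : trajectory u v -> trajectory u' v' ->
  0 <= t -> t <= T ->
  `|u t - u' t| + `|v t - v' t| <= K * (`|u 0 - u' 0| + `|v 0 - v' 0|).
Proof.
move=> uv uv' t0 tT; apply: sum_sqrt B1 _.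
by have [] := trajectory_dist2 uv uv' (lexx 0) t0 tT.
Qed.

(** Comparison with the zero trajectory, forward and backward in time. *)
Lemma trajectory_growth u v t : trajectory u v -> 0 <= t -> t <= T ->
  `|u t| + `|v t| <= K * (`|u 0| + `|v 0|) /\
  `|u 0| + `|v 0| <= K * (`|u t| + `|v t|).
Proof.
move=> uv t0 tT.
have [h1 h2] := trajectory_dist2 uv trajectory0 (lexx 0) t0 tT.
by rewrite /= !subr0 in h1 h2; split; exact: sum_sqrt B1 _.
Qed.

(** At the first zero [t1] the slope is negative: it is not 0 by the backward growth bound, nor
    positive because [u > 0] before. After [t1] the line [w] with this slope is nonpositive, so that
    [G] vanishes on it and it solves the equation; Gronwall's inequality identifies [u] with [w] at
    [T]. *)
Lemma trajectory_hits_zero u v t0 : trajectory u v -> 0 < u 0 ->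
  0 <= t0 <= T -> u t0 <= 0 -> u T <= 0 /\ v T < 0.
Proof.
move=> uv u0 /andP[t00 t0T] ut0.
have [_ _ uc ud] := uv.
pose S := [set t | 0 <= t <= t0 /\ u t <= 0].
have iS : has_inf S.
  by split; [exists t0; rewrite /S/= t00 lexx|exists 0 => x [/andP[]]].
pose t1 := inf S.
have t1t0 : t1 <= t0 by apply: inf_lbound; [case: iS|rewrite /S/= t00 lexx].
have t10 : 0 <= t1 by apply: lb_le_inf; [case: iS|move=> x [/andP[]]].
have near_u (x e : R) : 0 < e -> exists2 d, 0 < d & forall y, `|y - x| < d -> `|u y - u x| < e.
  move=> e0; have /cvgrPdist_lt/(_ e e0)/nbhs_ballP[d d0 Hd] := uc x.
  exists d => // y yx; rewrite distrC; apply: Hd.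
  by rewrite /ball/= distrC.
have before x : 0 <= x < t1 -> 0 < u x.
  move=> /andP[x0 xt1]; rewrite ltNge; apply/negP => ux.
  have : t1 <= x.
    by apply: inf_lbound; [case: iS|split => //; rewrite x0 (le_trans (ltW xt1))].
  by rewrite leNgt xt1.
have ut1 : u t1 = 0.
  apply/eqP; rewrite eq_le !leNgt; apply/andP; split; apply/negP => h.
    have [d d0 Hd] := near_u t1 _ h.
    have [x [/andP[x0 xt0] ux] xd] := inf_adherent d0 iS.
    have t1x : t1 <= x by apply: inf_lbound; [case: iS|split => //; rewrite x0].
    have := Hd x; rewrite ltr_distl => /(_ ltac:(lra_from u)); rewrite ltr_distl; lra_from u.
  have h' : 0 < - u t1 by lra_from u.
  have t1p : 0 < t1.
    by rewrite lt_neqAle t10 andbT; apply/eqP => E; move: h; rewrite -E; lra_from u.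
  have [d d0 Hd] := near_u t1 _ h'.
  pose x := Num.max 0 (t1 - d / 2).
  have xE : 0 <= x /\ t1 - d / 2 <= x by rewrite /x !le_max !lexx orbT.
  have xt1 : x < t1 by rewrite gt_max t1p/=; lra_from u.
  have := before x ltac:(rewrite xt1; lra_from u).
  have := Hd x; rewrite ltr_distl => /(_ ltac:(lra_from u)); rewrite ltr_distl; lra_from u.
have t1p : 0 < t1.
  by rewrite lt_neqAle t10 andbT; apply/eqP => E; move: ut1 u0; rewrite -E => ->; rewrite ltxx.
have t1T : t1 <= T by lra_from u.
have vt1 : v t1 < 0.
  rewrite lt_neqAle; apply/andP; split.
    apply/eqP => v0; have [_] := trajectory_growth uv t10 t1T.
    by rewrite ut1 v0 normr0 addr0 mulr0; have := normr_ge0 (v 0); rewrite [`|u 0|]gtr0_norm//; lra_from u.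
  rewrite leNgt; apply/negP => v0.
  have /is_derive1P/(_ (v t1 / 2)) := ud t1 ltac:(lra_from u).
  move=> /(_ ltac:(lra_from u)) [d d0 Hd].
  pose x := Num.max 0 (t1 - d / 2).
  have xE : 0 <= x /\ t1 - d / 2 <= x by rewrite /x !le_max !lexx orbT.
  have xt1 : x < t1 by rewrite gt_max t1p/=; lra_from u.
  have := before x ltac:(rewrite xt1; lra_from u).
  have := Hd x; rewrite ltr_distl => /(_ ltac:(lra_from u)).
  rewrite ut1 subr0 ler_norml [`|x - t1|]ltr0_norm ?subr_lt0// => /andP[_ h] ux.
  have : 0 < v t1 * (t1 - x) by rewrite mulr_gt0// subr_gt0.
  lra_from u.
pose w x := v t1 * (x - t1).
have wd : acd t1 T w (cst (v t1)).
  have := acdZ (v t1) (acdD (@acd_id R t1 T) (@acd_cst R t1 T (- t1))).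
  by move=> H; apply: (acd_ae H); apply: aeW => x _ /=; rewrite addr0 mulr1.
have pq := acdD (trajectory_acdu uv t10 (lexx T)) (acdN wd).
have qq := acdD (trajectory_acdv uv t1 T) (acdN (@acd_cst R t1 T (v t1))).
have li : mu.-integrable setT (EFin \o (fun x => L * `|a x|)).
  exact: integrable_scale.
have lge0 x : 0 <= L * `|a x| by apply: mulr_ge0 => //; exact: ltW.
have [|h1 _] := gronwall_system t1T li lge0 pq qq.
  apply: aeW => x; rewrite in_itv/= => /andP[t1x xT] /=.
  have wx : G (w x) = 0.
    by apply: G0; rewrite /w nmulr_rle0// subr_ge0 ltW.
  rewrite oppr0 addr0 normrN -[G (u x)]subr0 -wx normrM [L * _]mulrC -mulrA.
  by apply: ler_wpM2l => //; exact: GL.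
have uvT : u T - w T = 0 /\ v T - v t1 = 0.
  have wt1 : w t1 = 0 by rewrite /w subrr mulr0.
  move: h1; rewrite /= wt1 ut1 !subrr !expr0n/= addr0 mul0r => h1.
  have := sqr_ge0 (u T - w T); have := sqr_ge0 (v T - v t1) => h2 h3.
  by split; apply/eqP; rewrite -sqrf_eq0 eq_le; lra_from u.
have [uT vT] := uvT.
have wT : w T <= 0 by rewrite /w nmulr_rle0// subr_ge0.
by split; lra_from u.
Qed.

End trajectory.

(** * A priori estimates on trajectories and the two shooting arguments *)

Section shooting.
Variables (R : realType) (T : R) (a G : R -> R) (L : R).
Local Notation mu := (@lebesgue_measure R).
Hypothesis T0 : 0 < T.
Hypothesis ai : mu.-integrable setT (EFin \o a).
Hypothesis a0 : forall x, x <= 0 -> a x = 0.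
Hypothesis L0 : 0 < L.
Hypothesis GL : forall s t, `|G s - G t| <= L * `|s - t|.
Hypothesis G0 : forall s, s <= 0 -> G s = 0.

Local Notation traj := (trajectory T a G).
Local Notation K := (growth_constant T a L).
Local Notation A := (primitive (fun x => `|a x|)).

Let K2 : 2 <= K := growth_constant_ge2 a T0 L0.

Let growth u v t : traj u v -> 0 <= t -> t <= T ->
  `|u t| + `|v t| <= K * (`|u 0| + `|v 0|) /\
  `|u 0| + `|v 0| <= K * (`|u t| + `|v t|) := @trajectory_growth R T a G L T0 ai L0 GL G0 u v t.

(** By the mean value theorem [|v| <= M / (be - al)] at some point of the interval; the backward
    growth bound does the rest. *)
Lemma trajectory_data_bound u v al be M : traj u v ->
  0 <= al -> al < be -> be <= T -> (forall x, al <= x <= be -> 0 <= u x <= M) ->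
  `|u 0| + `|v 0| <= K * (M + M / (be - al)).
Proof.
move=> uv al0 alb bT uM.
have [x /andP[alx xb] E] := trajectory_MVT uv al0 alb bT.
have [_ h] := @growth u v x uv ltac:(lra) ltac:(lra).
apply: le_trans h _; apply: ler_wpM2l; first by have := K2; lra.
have ux := uM x ltac:(lra); rewrite lerD//; first by rewrite ger0_norm; lra.
rewrite ler_pdivlMr ?subr_gt0// -[be - al]gtr0_norm ?subr_gt0// -normrM -E.
by have := uM al ltac:(lra); have := uM be ltac:(lra); rewrite ler_norml; lra.
Qed.

(* Close to the endpoints a contributes little, so that u is nearly affine
   there and a steep slope would make u negative. *)
Lemma trajectory_slope_bounds : exists2 K3, 0 < K3 &
  forall u v, traj u v -> (forall x, 0 <= x <= T -> 0 < u x) ->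
  - (K3 * u 0) <= v 0 /\ v T <= K3 * u T.
Proof.
have T0' := T0; have K2' := K2; have L0' := L0.
have K0 : 0 < K by lra_from T0'.
have LK : 0 < 2 * L * K * K by do 3 apply: mulr_gt0 => //.
have e0 : 0 < (2 * L * K * K)^-1 by rewrite invr_gt0.
have Ac : continuous A by apply: primitive_continuous; exact: integrable_norm.
(* With this bound on the integral of [|a|], within distance [h] of an endpoint [v] changes by at
   most half of [u + |v|] at that endpoint. *)
have [h [h0 hT Ah AT]] : exists h, [/\ 0 < h, h <= T,
    A h - A 0 <= (2 * L * K * K)^-1 & A T - A (T - h) <= (2 * L * K * K)^-1].
  have /cvgrPdist_le/(_ _ e0)/nbhs_ballP[d1 d10 Hd1] := Ac 0.
  have /cvgrPdist_le/(_ _ e0)/nbhs_ballP[d2 d20 Hd2] := Ac T.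
  pose h := Num.min (Num.min (d1 / 2) (d2 / 2)) T.
  have hE : [/\ h <= d1 / 2, h <= d2 / 2 & h <= T] by rewrite /h !ge_min !lexx !orbT.
  have h0 : 0 < h by rewrite /h !lt_min T0' !divr_gt0.
  case: hE => h1 h2 h3; rewrite /= in d10 d20.
  exists h; split => //.
    have /Hd1 : ball 0 d1 h by rewrite /ball/= sub0r normrN gtr0_norm//; lra_from T0'.
    by move=> /=; rewrite ler_distl; lra_from T0'.
  have /Hd2 : ball T d2 (T - h) by rewrite /ball/= opprB addrC subrK gtr0_norm//; lra_from T0'.
  by move=> /=; rewrite ler_distl; lra_from T0'.
exists (1 + 2 / h); first by rewrite addr_gt0// divr_gt0.
move=> u v uv up.
have u0 := up 0 ltac:(lra_from T0'); have uT := up T ltac:(lra_from T0').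
have Gu m x : 0 <= x <= T -> `|u 0| + `|v 0| <= K * m -> `|G (u x)| <= L * (K * (K * m)).
  move=> /andP[x0 xT] um; rewrite -[G _]subr0 -(G0 (lexx 0)).
  apply: le_trans (GL _ _) _; rewrite subr0 ler_pM2l//.
  have [h1 _] := growth uv x0 xT; rewrite -(ler_pM2l K0) in um.
  apply: le_trans um; apply: le_trans h1; by rewrite lerDl.
have halve m w : 0 <= m -> w <= (2 * L * K * K)^-1 -> L * (K * (K * m)) * w <= m / 2.
  move=> m0 hw; apply: (@le_trans _ _ (L * (K * (K * m)) * (2 * L * K * K)^-1)).
    apply: ler_wpM2l => //; apply: mulr_ge0; first exact: ltW.
    by do 2 (apply: mulr_ge0; first exact: ltW).
  rewrite le_eqVlt; apply/orP; left; apply/eqP; field.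
  by rewrite !gt_eqF.
(* Here [c] is the value of [u] at the endpoint, [p] the rate at which [u] falls on moving inwards
   from there, and [q] that rate at a mean value point: [q >= (p - c) / 2], while [h q < c] because
   [u] is still positive at distance [h]. *)
have key c p q : 0 < c -> 0 < c - h * q -> `|q - p| <= (c + `|p|) / 2 -> p <= (1 + 2 / h) * c.
  move=> c0 cq; rewrite ler_distl => pq.
  have [p0|p0] := leP p 0.
    by apply: le_trans p0 _; apply: mulr_ge0 (ltW c0); rewrite addr_ge0// divr_ge0// ltW.
  rewrite gtr0_norm// in pq.
  have hp : h * (p - c) <= h * (2 * q) by rewrite ler_pM2l//; lra_from T0'.
  rewrite -(ler_pM2l h0) (_ : h * ((1 + 2 / h) * c) = h * c + 2 * c); last first.
    by field; rewrite gt_eqF.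
  lra_from T0'.
split.
  have [x /andP[x0 xh] E] := trajectory_MVT uv (lexx 0) h0 hT.
  have uh := up h ltac:(lra_from T0').
  have vx : `|v x - v 0| <= (u 0 + `|v 0|) / 2.
    apply: le_trans (halve (u 0 + `|v 0|) (A x - A 0) _ _).
    - apply: (trajectory_vB ai uv (ltW x0)) => y yx; apply: Gu; first lra_from T0'.
      rewrite [`|u 0|]gtr0_norm// ler_peMl//; last lra_from T0'.
      by rewrite addr_ge0// ltW.
    - by rewrite addr_ge0// ltW.
    - apply: le_trans Ah; rewrite lerD2r; apply: primitive_mono => //; last exact: ltW.
      exact: integrable_norm.
  rewrite lerNl; apply: (@key (u 0) (- v 0) (- v x)) => //.
    by rewrite mulrN opprK mulrC -[h]subr0 -E; lra_from T0'.
  by rewrite -opprD !normrN.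
have [|||x /andP[x0 xh] E] := @trajectory_MVT _ _ _ _ _ _ uv (T - h) T; [lra_from T0'..|].
have uh := up (T - h) ltac:(lra_from T0').
have vx : `|v x - v T| <= (u T + `|v T|) / 2.
  rewrite distrC; apply: le_trans (halve (u T + `|v T|) (A T - A x) _ _).
  - apply: (trajectory_vB ai uv (ltW xh)) => y yx; apply: Gu; first lra_from T0'.
    by rewrite -{1}[u T]gtr0_norm//; have [_] := growth uv (ltW T0) (lexx T).
  - by rewrite addr_ge0// ltW.
  - apply: le_trans AT; rewrite lerD2l lerN2; apply: primitive_mono => //; last exact: ltW.
    exact: integrable_norm.
apply: (@key (u T) (v T) (v x)) => //.
have -> : h * v x = u T - u (T - h).
  by rewrite E opprB [T + _]addrC subrK mulrC.
by rewrite opprB [u T + _]addrC subrK.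
Qed.

Hypothesis G_mono : forall s t, s <= t -> G s <= G t.
Hypothesis G_gt0 : forall s, 0 < s -> 0 < G s.
Hypothesis G_small : forall e, 0 < e -> exists2 r, 0 < r &
  forall s t, 0 <= s <= r -> 0 <= t <= r -> `|G s - G t| <= e * `|s - t|.
Hypothesis a_neg : primitive a T < 0.

(* On a small trajectory u is nearly constant relative to the size of G, and
   int a G(u) is close to G(u 0) int a < 0. *)
Lemma small_trajectory :
  exists2 r, 0 < r & forall u v, traj u v -> 0 < u 0 ->
    (forall x, 0 <= x <= T -> u x <= r) -> (exists2 x, 0 <= x <= T & v x = 0) ->
    (forall x, 0 <= x <= T -> 0 < u x) /\
    G (u 0) * (- primitive a T / 2) <= v T - v 0.
Proof.
have T0' := T0.
have nai : mu.-integrable setT (EFin \o (fun x => `|a x|)) by exact: integrable_norm.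
set m := A T; set io := - primitive a T.
have io0 : 0 < io by rewrite /io oppr_gt0.
have m0 : 0 <= m by exact: primitive_ge0.
(* e is such that e T m <= 1/2 and 2 e T m^2 <= io / 2 *)
pose e := Num.min (2 * (T * m + 1))^-1 (io / (4 * (T * m * m + 1))).
have p1 : 0 < 2 * (T * m + 1) by rewrite mulr_gt0// ltr_wpDl// mulr_ge0// ltW.
have p2 : 0 < 4 * (T * m * m + 1) by rewrite mulr_gt0// ltr_wpDl// !mulr_ge0// ltW.
have e0 : 0 < e by rewrite /e lt_min invr_gt0 p1 divr_gt0.
have e1 : e * (T * m) <= 2^-1.
  apply: (@le_trans _ _ ((2 * (T * m + 1))^-1 * (T * m))).
    by rewrite ler_wpM2r ?mulr_ge0 ?(ltW T0)// /e ge_min lexx.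
  rewrite mulrC ler_pdivrMr// mulrA mulVf ?mul1r// lerDl; exact: ler01.
have e2 : 2 * e * (T * m) * m <= io / 2.
  apply: (@le_trans _ _ (2 * (io / (4 * (T * m * m + 1))) * (T * m) * m)).
    do 2 (apply: ler_wpM2r; first by rewrite ?mulr_ge0 ?(ltW T0)).
    by rewrite ler_pM2l// /e ge_min lexx orbT.
  have -> : 2 * (io / (4 * (T * m * m + 1))) * (T * m) * m =
      io / 2 * ((T * m * m) / (T * m * m + 1)).
    by field; rewrite gt_eqF//; lra_from T0'.
  rewrite ler_piMr ?divr_ge0 ?(ltW io0)// ler_pdivrMr; last lra_from T0'.
  by rewrite mul1r lerDl.
have [r r0 Gr] := G_small e0; exists r => // u v uv u0 ur [xi /andP[xi0 xiT] vxi].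
have [_ i uc _] := uv.
have [x1 x1T x1max] := EVT_max (ltW T0) (continuous_subspaceT uc).
rewrite in_itv/= in x1T.
have Gmax x : 0 <= x <= T -> `|G (u x)| <= G (u x1).
  move=> xT; have Gge0 s : 0 <= G s.
    have [s0|s0] := leP s 0; first by rewrite G0.
    exact/ltW/G_gt0.
  by rewrite ger0_norm//; apply: G_mono; apply: x1max; rewrite in_itv.
set g1 := G (u x1) in Gmax *.
have ux1 : 0 < u x1 by apply: lt_le_trans u0 _; apply: x1max; rewrite in_itv/= lexx ltW.
have g10 : 0 < g1 by exact: G_gt0.
have Am s t : 0 <= s -> s <= t -> t <= T -> g1 * (A t - A s) <= g1 * m.
  move=> s0 st tT; rewrite ler_pM2l//.
  have h1 : A t <= m by exact: primitive_mono.
  have h2 : 0 <= A s by exact: primitive_ge0.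
  lra_from T0'.
(* The zero [xi] of [v] is used here: all of [v], and then the oscillation of [u], is controlled by
   the maximum [g1] of [G (u x)]. *)
have vm x : 0 <= x <= T -> `|v x| <= g1 * m.
  move=> /andP[x0 xT]; rewrite -[v x]subr0 -vxi.
  have [xxi|xix] := leP x xi.
    rewrite distrC; apply: le_trans (Am x xi x0 xxi xiT).
    by apply: (trajectory_vB ai uv) => // y yx; apply: Gmax; lra_from T0'.
  apply: le_trans (Am xi x xi0 (ltW xix) xT).
  by apply: (trajectory_vB ai uv) => //; [exact: ltW|move=> y yx; apply: Gmax; lra_from T0'].
have uxT x : 0 <= x <= T -> u x1 - u x <= g1 * (T * m).
  move=> xT; have key s t : 0 <= s -> s < t -> t <= T -> `|u t - u s| <= g1 * (T * m).
    move=> s0 st tT; have [y yst ->] := trajectory_MVT uv s0 st tT.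
    rewrite normrM [T * m]mulrC mulrA; apply: ler_pM => //.
      by apply: vm; lra_from T0'.
    by rewrite gtr0_norm; lra_from T0'.
  have [xx1|x1x|->] := ltgtP x x1.
  - by apply: le_trans (ler_norm _) _; apply: key; lra_from T0'.
  - by apply: le_trans (ler_norm _) _; rewrite distrC; apply: key; lra_from T0'.
  - by rewrite subrr; apply: mulr_ge0; [exact: ltW|apply: mulr_ge0 => //; exact: ltW].
(* On [[0, r]] the function [G] is Lipschitz with constant [e], so that [G (u x)] loses at most half
   of its maximum; this excludes [u x <= 0], where [G] vanishes. *)
have GD x : 0 <= x <= T -> g1 - G (u x) <= e * (T * m) * g1.
  move=> xT; have ux1r := ur x1 x1T; have uxr := ur x xT; have ux := uxT x xT.
  have ux1x : u x <= u x1 by apply: x1max; rewrite in_itv.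
  have [ux0|ux0] := leP (u x) 0.
    rewrite (G0 ux0) -(G0 (lexx 0)); apply: le_trans (ler_norm _) _.
    apply: le_trans (Gr _ _ _ _) _; [lra_from T0'|lra_from T0'|].
    rewrite -mulrA ler_pM2l// subr0 gtr0_norm// mulrC; lra_from T0'.
  apply: le_trans (ler_norm _) _.
  apply: le_trans (Gr _ _ _ _) _; [lra_from T0'|lra_from T0'|].
  by rewrite -mulrA ler_pM2l// ger0_norm ?subr_ge0// mulrC.
have G2 x : 0 <= x <= T -> g1 <= 2 * G (u x).
  move=> xT; have := GD x xT.
  have : e * (T * m) * g1 <= 2^-1 * g1 by rewrite ler_pM2r.
  lra_from T0'.
split.
  move=> x xT; rewrite ltNge; apply/negP => /G0 Gx.
  by have := G2 x xT; rewrite Gx mulr0 leNgt g10.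
have oT : 0 <= (0 : R) <= T by rewrite lexx ltW.
have cT := G2 0 oT; have GDc := GD 0 oT.
set c := G (u 0) in cT GDc *.
have c0 : 0 < c by exact: G_gt0.
have vT : v T - v 0 = c * io - primitive (fun x => a x * G (u x) - c * a x) T.
  rewrite primitive_sub//; last exact: integrable_scale.
  rewrite primitiveZl// (trajectory_vE uv T) /io; ring.
have di : mu.-integrable setT (EFin \o (fun x => a x * G (u x) - c * a x)).
  have := integrableB measurableT i (integrable_scale c ai); by apply: eq_integrable.
(* Both [G (u x)] and [c] lie within [e T m g1] below [g1], and [g1 <= 2 c]; the second condition on
   [e] absorbs the integral of the difference. *)
have err : primitive (fun x => a x * G (u x) - c * a x) T <= c * (io / 2).
  apply: le_trans (ler_norm _) _; apply: le_trans (normr_primitive _ di) _.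
  apply: (@le_trans _ _ (2 * e * (T * m) * c * m)).
    rewrite -primitiveZl//; apply: le_primitive.
    - exact: integrable_norm.
    - exact: integrable_scale.
    - move=> x xT; have [x0|x0] := leP x 0; first by rewrite a0// mulr0 mul0r subr0 normr0 mulr0.
      rewrite [c * _]mulrC -mulrBr normrM mulrC ler_wpM2r//.
      have xT' : 0 <= x <= T by rewrite ltW.
      have := GD x xT'; have := le_trans (ler_norm _) (Gmax x xT').
      have := le_trans (ler_norm _) (Gmax 0 oT); rewrite -/c.
      rewrite (_ : 2 * e * (T * m) * c = e * (T * m) * (2 * c)); last by ring.
      have : e * (T * m) * g1 <= e * (T * m) * (2 * c).
        by rewrite ler_wpM2l//; apply: mulr_ge0; [exact: ltW|apply: mulr_ge0 => //; exact: ltW].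
      rewrite ler_norml; move: GDc; clear.
      move: (e * (T * m) * _) (e * (T * m) * _) (G (u x)) => *; lra.
  rewrite mulrAC mulrC ler_pM2l//.
rewrite vT; lra_from T0'.
Qed.

Variable C : R.
Hypothesis C_bound : forall u v, traj u v -> (forall x, 0 <= x <= T -> 0 < u x) ->
  `|u 0| + `|v 0| < C.

Let pos_or_hit u v : traj u v -> 0 < u 0 ->
  (forall x, 0 <= x <= T -> 0 < u x) \/ u T <= 0 /\ v T < 0.
Proof.
move=> uv u0; have [|/existsNP[x]] := pselect (forall x, 0 <= x <= T -> 0 < u x).
  by left.
move=> /not_implyP[xT /negP]; rewrite -leNgt => ux; right.
exact: (trajectory_hits_zero T0 ai L0 GL G0 uv u0 xT ux).
Qed.

Let far_hit u v : traj u v -> 0 < u 0 -> C <= `|u 0| + `|v 0| -> u T <= 0 /\ v T < 0.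
Proof.
move=> uv u0 uC; have [up|//] := pos_or_hit uv u0.
by have := C_bound uv up; rewrite ltNge uC.
Qed.

Let flow_ex : exists Phi : R * R -> (R -> R) * (R -> R), forall p,
  [/\ traj (Phi p).1 (Phi p).2, (Phi p).1 0 = p.1 & (Phi p).2 0 = p.2].
Proof.
have [f Hf] := choice (fun p => trajectory_exists T0 ai a0 L0 GL p.1 p.2).
by exists f.
Qed.

Let Phi := projT1 (cid flow_ex).
Let U c d := (Phi (c, d)).1.
Let V c d := (Phi (c, d)).2.

Let UV c d : traj (U c d) (V c d).
Proof. by have [] := projT2 (cid flow_ex) (c, d). Qed.

Let U0 c d : U c d 0 = c.
Proof. by have [] := projT2 (cid flow_ex) (c, d). Qed.

Let V0 c d : V c d 0 = d.
Proof. by have [] := projT2 (cid flow_ex) (c, d). Qed.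

Let flow_lipschitz c d c' d' :
  `|U c d T - U c' d' T| + `|V c d T - V c' d' T| <= K * (`|c - c'| + `|d - d'|).
Proof.
have := trajectory_lipschitz T0 ai L0 GL (UV c d) (UV c' d') (ltW T0) (lexx T).
by rewrite !U0 !V0.
Qed.

Let K0 : 0 < K. Proof. exact: lt_le_trans K2. Qed.

Let small u v r : traj u v -> K * (`|u 0| + `|v 0|) <= r -> forall x, 0 <= x <= T -> u x <= r.
Proof.
move=> uv h x /andP[x0 xT]; apply: le_trans h; have [h _] := growth uv x0 xT.
by apply: le_trans h; apply: le_trans (ler_norm _) _; rewrite lerDl.
Qed.

(** Some positive trajectory exists, namely a small one with initial slope 0, and [C] exceeds its
    data. *)
Let C0 : 0 < C.
Proof.
have T0' := T0.
have [r r0 Hr] := small_trajectory.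
pose c := r / K; have c0 : 0 < c by exact: divr_gt0.
have [up _] := @Hr (U c 0) (V c 0) (UV c 0) ltac:(by rewrite U0)
  (@small _ _ r (UV c 0) ltac:(by rewrite U0 V0 normr0 addr0 gtr0_norm// mulrC divfK ?gt_eqF))
  ltac:(by exists 0; rewrite ?V0// lexx ltW).
apply: le_lt_trans (C_bound (UV c 0) up); exact: addr_ge0.
Qed.

(** The slope at [T] is positive for the small height [c0] and negative for the height [C]. Where it
    vanishes the trajectory cannot have reached 0, since its slope at [T] would be negative. *)
Lemma neumann_shooting : exists u v, [/\ traj u v,
  forall x, 0 <= x <= T -> 0 < u x, v 0 = 0 & v T = 0].
Proof.
have [r r0 Hr] := small_trajectory.
pose c0 := Num.min (r / K) C.
have c00 : 0 < c0 by rewrite /c0 lt_min C0 divr_gt0.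
have c0C : c0 <= C by rewrite /c0 ge_min lexx orbT.
have start : 0 < V c0 0 T.
  have [_] := @Hr (U c0 0) (V c0 0) (UV c0 0) ltac:(by rewrite U0)
    (@small _ _ r (UV c0 0) ltac:(by rewrite U0 V0 normr0 addr0 gtr0_norm// mulrC -ler_pdivlMr// /c0 ge_min lexx))
    ltac:(by exists 0; rewrite ?V0// lexx ltW).
  rewrite U0 V0 subr0; apply: lt_le_trans; rewrite mulr_gt0 ?G_gt0//.
  by rewrite divr_gt0// oppr_gt0.
have stop : V C 0 T < 0.
  by have [] := far_hit (UV C 0); rewrite ?U0 ?V0// normr0 addr0 gtr0_norm.
have [||c cC Vc] := @IVT R (fun c => V c 0 T) c0 C 0 c0C.
- apply: continuous_subspaceT; apply: (lipschitz_continuous K0) => s t.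
  have := flow_lipschitz s 0 t 0; rewrite subrr normr0 addr0.
  by apply: le_trans; rewrite lerDr.
- by rewrite /= ge_min le_max (ltW start) (ltW stop) orbT.
rewrite in_itv/= in cC.
exists (U c 0), (V c 0); split; [exact: UV| |exact: V0|exact: Vc].
have [|//|[_]] := pos_or_hit (UV c 0); last by rewrite Vc ltxx.
by rewrite U0; apply: lt_le_trans c00 _; case/andP: cC.
Qed.

(** Apply [planar_zero] on [[ep, C]] times [[- D, D]] with [ym = de]. A common zero has
    [u T = c > 0], and hence stays positive. *)
Lemma periodic_shooting : exists u v, [/\ traj u v,
  forall x, 0 <= x <= T -> 0 < u x, u T = u 0 & v T = v 0].
Proof.
have T0' := T0; have K0' := K0; have K2' := K2; have C0' := C0.
have [r r0 Hr] := small_trajectory.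
have [K3 K30 slope] := trajectory_slope_bounds.
have m0 : 0 <= A T by exact: primitive_ge0.
have AK : 0 < 4 * (A T * K + 1) by rewrite mulr_gt0// ltr_wpDl// mulr_ge0// ltW.
have [r' r'0 Gr] := G_small (ltac:(by rewrite invr_gt0) : 0 < (4 * (A T * K + 1))^-1).
pose de := Num.min r r' / (2 * K).
have de0 : 0 < de by apply: divr_gt0; [rewrite lt_min r0|apply: mulr_gt0].
have [der der'] : K * (de + de) <= r /\ K * (de + de) <= r'.
  have -> : K * (de + de) = Num.min r r' by rewrite /de; field; rewrite gt_eqF.
  by rewrite !ge_min !lexx orbT.
clearbody de.
(* The four bounds: data up to [(ep, de)] remain small; a positive trajectory from height [ep] has
   [v 0 >= - de]; one returning to [ep] with a nonnegative slope has [v 0 < de]; and [ep < C]. *)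
pose ep := Num.min (Num.min de (de / K3)) (Num.min (de / (2 * (K * (1 + K3)))) (C / 2)).
have K13 : 0 < 2 * (K * (1 + K3)) by do 2 apply: mulr_gt0 => //; lra_from T0'.
have ep0 : 0 < ep by rewrite /ep !lt_min; apply/andP; split; apply/andP; split => //; exact: divr_gt0.
have [ep1 ep2 ep3 ep4] : [/\ ep <= de, K3 * ep <= de, K * (1 + K3) * ep < de & ep < C].
  have [e1 e2 e3 e4] : [/\ ep <= de, ep <= de / K3, ep <= de / (2 * (K * (1 + K3))) & ep <= C / 2].
    by rewrite /ep !ge_min !lexx !orbT.
  split => //; [by rewrite mulrC -ler_pdivlMr| |lra_from T0'].
  rewrite ler_pdivlMr// in e3; lra_from T0'.
clearbody ep.
pose F1 c d := U c d T - c; pose F2 c d := V c d T - d.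
have F1K c d c' d' : `|F1 c d - F1 c' d'| <= (K + 1) * (`|c - c'| + `|d - d'|).
  have := flow_lipschitz c d c' d'.
  have -> : F1 c d - F1 c' d' = (U c d T - U c' d' T) - (c - c') by rewrite /F1; ring.
  have := ler_normB (U c d T - U c' d' T) (c - c').
  have := normr_ge0 (V c d T - V c' d' T); have := normr_ge0 (d - d').
  rewrite mulrDl mul1r; move: (K * _) => w; lra_from T0'.
have F2K c d c' d' : `|F2 c d - F2 c' d'| <= (K + 1) * (`|c - c'| + `|d - d'|).
  have := flow_lipschitz c d c' d'.
  have -> : F2 c d - F2 c' d' = (V c d T - V c' d' T) - (d - d') by rewrite /F2; ring.
  have := ler_normB (V c d T - V c' d' T) (d - d').
  have := normr_ge0 (U c d T - U c' d' T); have := normr_ge0 (c - c').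
  rewrite mulrDl mul1r; move: (K * _) => w; lra_from T0'.
pose D := C + de.
have far c d : 0 < c -> C <= `|c| + `|d| -> F1 c d < 0.
  move=> c0 cd; have [||] := far_hit (UV c d); rewrite ?U0 ?V0//.
  by rewrite /F1; lra_from T0'.
have pos c d : 0 < c -> F1 c d = 0 -> forall x, 0 <= x <= T -> 0 < U c d x.
  move=> c0 F10; have [|//|[UT _]] := pos_or_hit (UV c d); first by rewrite U0.
  by move: F10; rewrite /F1; lra_from T0'.
have io0 : 0 < G ep * (- primitive a T / 2).
  by rewrite mulr_gt0 ?G_gt0// divr_gt0// oppr_gt0.
(* By the choice of [r'], [G] is so flat at this size that [v] changes by at most [de / 2]; it
   remains positive at the mean value point of [u T - u 0]. *)
have start : 0 < F1 ep de.
  have [x xT E] := trajectory_MVT (UV ep de) (lexx 0) T0 (lexx T).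
  rewrite /F1 -{2}(U0 ep de) E subr0 mulr_gt0//.
  have E0 : 0 <= (4 * (A T * K + 1))^-1 * (K * (de + de)).
    apply: mulr_ge0; first by rewrite invr_ge0 ltW.
    by apply: mulr_ge0; [exact: ltW|lra_from T0'].
  have Gu y : 0 <= y <= x -> `|G (U ep de y)| <= (4 * (A T * K + 1))^-1 * (K * (de + de)).
    move=> yx; have yT : 0 <= y <= T by lra_from T0'.
    have [/andP[y0 yT']] := yT.
    have [h _] := growth (UV ep de) y0 yT'; rewrite U0 V0 [`|ep|]gtr0_norm// [`|de|]gtr0_norm// in h.
    have uK : `|U ep de y| <= K * (de + de).
      have : K * (ep + de) <= K * (de + de) by rewrite ler_pM2l// lerD2r.
      have := normr_ge0 (V ep de y); lra_from T0'.
    have [u0|u0] := leP (U ep de y) 0.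
      by rewrite G0// normr0.
    rewrite -[G _]subr0 -(G0 (lexx 0)); apply: le_trans (Gr _ _ _ _) _.
    - by rewrite ltW//= (le_trans (ler_norm _))// (le_trans uK).
    - by rewrite lexx ltW.
    - by rewrite subr0 ler_pM2l// invr_gt0.
  have := trajectory_vB ai (UV ep de) (ltac:(lra_from T0') : 0 <= x) Gu.
  have : (4 * (A T * K + 1))^-1 * (K * (de + de)) * (A x - A 0) <= de / 2.
    apply: (@le_trans _ _ ((4 * (A T * K + 1))^-1 * (K * (de + de)) * A T)).
      apply: ler_wpM2l => //.
      have : 0 <= A 0 by exact: primitive_ge0.
      have : A x <= A T by apply: primitive_mono => //; [exact: integrable_norm|lra_from T0'].
      lra_from T0'.
    have -> : (4 * (A T * K + 1))^-1 * (K * (de + de)) * A T =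
        de / 2 * ((A T * K) / (A T * K + 1)).
      by field; rewrite gt_eqF//; lra_from T0'.
    rewrite ler_piMr ?divr_ge0 ?(ltW de0)// ler_pdivrMr; last lra_from T0'.
    by rewrite mul1r lerDl.
  rewrite V0 => h1 h2; have := le_trans h2 h1; rewrite ler_distl; lra_from T0'.
have [|||||||||||||c [d [cC _ F10 F20]]] := @planar_zero R F1 F2 (K + 1) ep C (- D) D de
    (Num.min (G ep * (- primitive a T / 2)) de).
- lra_from T0'.
- exact: F1K.
- exact: F2K.
- exact: ep4.
- by rewrite /D; lra_from T0'.
- by rewrite /D; lra_from T0'.
- by move=> d _; apply: far => //; rewrite [`|C|]gtr0_norm// lerDl.
- move=> c cC; apply: far; first lra_from T0'.
  by rewrite normrN [`|D|]gtr0_norm /D; have := normr_ge0 c; lra_from T0'.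
- move=> c cC; apply: far; first lra_from T0'.
  by rewrite [`|D|]gtr0_norm /D; have := normr_ge0 c; lra_from T0'.
- exact: start.
- by rewrite lt_min io0.
(* The slope bound gives [|d| <= de], and [u T = u 0] provides a zero of [v], so that
   [small_trajectory] applies. *)
- move=> d dD F10; have up := pos _ _ ep0 F10.
  have [+ _] := slope _ _ (UV ep d) up; rewrite U0 V0 => dlow.
  have dde : `|d| <= de by rewrite ler_norml; lra_from T0'.
  have [|||_] := Hr _ _ (UV ep d).
  + by rewrite U0.
  + apply: small (UV ep d) _; rewrite U0 V0; apply: le_trans der.
    by rewrite ler_pM2l// lerD// gtr0_norm.
  + have [x xT E] := trajectory_MVT (UV ep d) (lexx 0) T0 (lexx T).
    exists x; first lra_from T0'.
    have : V ep d x * (T - 0) = 0 by rewrite -E U0.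
    by move/eqP; rewrite mulf_eq0 subr0 [T == 0]gt_eqF// orbF => /eqP.
  + by rewrite U0 V0 => h; apply: le_trans h; rewrite ge_min lexx.
(* If [v T < 0], then [F2 < - d <= - de]. Otherwise [0 <= v T <= K3 ep], and the backward growth
   bound gives [d < de], a contradiction. *)
- move=> d dD F10; have up := pos _ _ ep0 F10.
  have [_] := slope _ _ (UV ep d) up.
  have -> : U ep d T = ep by move: F10; rewrite /F1; lra_from T0'.
  move=> VT; rewrite lerNr ge_min; apply/orP; right.
  rewrite lerNr /F2; have [VT0|VT0] := ltP (V ep d T) 0; first lra_from T0'.
  have [_] := growth (UV ep d) (ltW T0) (lexx T).
  have -> : U ep d T = ep by move: F10; rewrite /F1; lra_from T0'.
  rewrite U0 V0 (ger0_norm VT0) !gtr0_norm//; last lra_from T0'.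
  have : K * (ep + V ep d T) <= K * (ep + K3 * ep) by rewrite ler_pM2l// lerD2l.
  lra_from T0'.
exists (U c d), (V c d); rewrite U0 V0; split.
- exact: UV.
- by apply: pos => //; lra_from T0'.
- by move: F10; rewrite /F1; lra_from T0'.
- by move: F20; rewrite /F2; lra_from T0'.
Qed.

End shooting.

(** * Bounds from superlinearity *)

Section concave_bound.
Variables (R : realType) (T : R) (a : R -> R) (al be : R).
Local Notation mu := (@lebesgue_measure R).
Hypothesis ai : mu.-integrable setT (EFin \o a).
Hypothesis al0 : 0 <= al.
Hypothesis beT : be <= T.
Hypothesis a_ge0 : {ae mu, forall x : R, x \in `]al, be[ -> 0 <= a x}.
Hypothesis a_neq0 : ~ {ae mu, forall x : R, x \in `]al, be[ -> a x = 0}.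

Lemma support_nondegenerate : al < be.
Proof.
rewrite ltNge; apply/negP => ba; apply: a_neq0; apply: aeW => x.
by rewrite in_itv/= => /andP[? ?]; exfalso; lra.
Qed.

Lemma primitive_nondecreasing_in s t : al <= s -> s <= t -> t <= be ->
  primitive a s <= primitive a t.
Proof.
move=> als st tb; apply: (acd_nondecreasing st (acd_primitive s t ai)).
by apply: ae_imp a_ge0 => x h xst; apply: h; move: xst; rewrite !in_itv/=; lra.
Qed.

(** If the integral over the whole interval were 0, the primitive would be constant and [a] zero
    almost everywhere. By continuity positivity survives a slight shrinking of the interval. *)
Lemma primitive_gt0_in : exists2 h, 0 < h &
  al + h < be - h /\ 0 < primitive a (be - h) - primitive a (al + h).
Proof.
have ab := support_nondegenerate.
have H : 0 < primitive a be - primitive a al.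
  rewrite subr_gt0 lt_neqAle; apply/andP; split; last first.
    by apply: primitive_nondecreasing_in => //; exact: ltW.
  apply/negP => /eqP E; apply: a_neq0.
  apply: ae_imp (primitive_is_derive ai) => x dx; rewrite in_itv/= => xab.
  have cst_x y : al <= y <= be -> primitive a y = primitive a al.
    move=> yab; apply/eqP; rewrite eq_le {1}E !primitive_nondecreasing_in//; lra_from ab.
  have dx0 : is_derive x (1 : R) (primitive a) 0.
    apply/is_derive1P => e e0; exists (Num.min (x - al) (be - x)).
      by rewrite lt_min; lra_from ab.
    move=> y; rewrite lt_min !ltr_distl => yx.
    rewrite (cst_x y) ?(cst_x x); [|lra_from ab|lra_from ab].
    by rewrite subrr mul0r subr0 normr0 mulr_ge0// ltW.
  by have := @derive_val _ _ _ _ _ _ _ dx0; rewrite (@derive_val _ _ _ _ _ _ _ dx).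
have cont := primitive_continuous ai.
set d := primitive a be - primitive a al in H.
have d4 : 0 < d / 4 by lra_from ab.
have /cvgrPdist_lt/(_ _ d4)/nbhs_ballP[d1 d10 Hd1] := cont al.
have /cvgrPdist_lt/(_ _ d4)/nbhs_ballP[d2 d20 Hd2] := cont be.
rewrite /= in d10 d20.
pose h := Num.min (Num.min (d1 / 2) (d2 / 2)) ((be - al) / 3).
have [h1 h2 h3] : [/\ h <= d1 / 2, h <= d2 / 2 & h <= (be - al) / 3].
  by rewrite /h !ge_min !lexx !orbT.
have h0 : 0 < h by rewrite /h !lt_min; apply/andP; split; [apply/andP; split|]; lra_from ab.
exists h => //; split; first lra_from ab.
have /Hd1/= : ball al d1 (al + h).
  by rewrite /ball/= opprD addrA subrr add0r normrN gtr0_norm//; lra_from ab.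
have /Hd2/= : ball be d2 (be - h).
  by rewrite /ball/= opprB addrC subrK gtr0_norm//; lra_from ab.
rewrite !ltr_distl /d; lra_from ab.
Qed.

(* On [al, be] u is concave, hence at least q M on the middle part, M being its
   maximum; if G s >= k s there, u'' is too negative for u to stay positive. *)
Lemma concave_bound : exists k q : R, [/\ 0 < k, 0 < q &
  forall G u v r, trajectory T a G u v -> (forall s, 0 <= G s) ->
    (forall s, r <= s -> k * s <= G s) -> 0 < r ->
    (forall x, al <= x <= be -> 0 < u x) ->
    forall x, al <= x <= be -> u x <= r / q].
Proof.
have al0' := al0; have beT' := beT.
have ab := support_nondegenerate.
have [h h0 [hab]] := primitive_gt0_in.
set p := _ - primitive a _ => p0.
(* Let [w] be the absolute slope at [x], at distance at least [h] from the ends. Concavity gives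
   [u x1 <= u x + w (be - al)], and positivity at an end gives [w h <= u x]; eliminate [w]. *)
pose q := h / (h + (be - al)).
have hb : 0 < h + (be - al) by lra_from al0'.
have q0 : 0 < q by exact: divr_gt0.
have qE : q * (h + (be - al)) = h by rewrite /q divfK ?gt_eqF.
clearbody q.
(* Chosen so that [k h q p > 2]: the slope drops by at least [k q M p] across the middle part,
   whereas positivity at both ends allows a drop of at most [2 M / h]. *)
exists (2 / (h * q * p) + 1), q; split => //.
  by rewrite addr_gt0// divr_gt0// !mulr_gt0.
move=> G u v r uv G0 Gk r0 up.
have [_ i uc _] := uv.
have vmono s t : al <= s -> s <= t -> t <= be -> v t <= v s.
  move=> als st tb; rewrite -lerN2.
  apply: (acd_nondecreasing st (acdN (trajectory_acdv uv s t))).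
  apply: ae_imp a_ge0 => x ax xst /=; rewrite opprK mulr_ge0// ax//.
  by move: xst; rewrite !in_itv/=; lra_from al0'.
have [x1 x1ab x1max] := EVT_max (ltW ab) (continuous_subspaceT uc).
rewrite in_itv/= in x1ab.
have M0 : 0 < u x1 by exact: up.
have mvt s t : al <= s -> s < t -> t <= be -> v t * (t - s) <= u t - u s <= v s * (t - s).
  move=> als st tb; have [x xst ->] := trajectory_MVT uv (le_trans al0' als) st (le_trans tb beT').
  by rewrite !ler_pM2r ?subr_gt0// !vmono//; lra_from al0'.
have qM x : al + h <= x <= be - h -> q * u x1 <= u x.
  move=> xh; have uxp : 0 < u x by apply: up; lra_from al0'.
  have q1 : q <= 1 by rewrite -(ler_pM2r hb) qE; lra_from al0'.
  have easy : u x1 <= u x -> q * u x1 <= u x.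
    by apply: le_trans; rewrite ger_pMl.
  have step w z : 0 <= w -> 0 <= z <= be - al -> u x1 - u x <= w * z -> w * h <= u x ->
      q * u x1 <= u x.
    move=> w0 zz h1 h2; rewrite -(ler_pM2r hb) mulrAC qE.
    have e1 : h * u x1 <= h * (u x + w * z) by rewrite ler_pM2l//; lra_from al0'.
    have e2 : h * (w * z) <= u x * (be - al).
      rewrite mulrA [h * w]mulrC; apply: (@le_trans _ _ (w * h * (be - al))).
        by rewrite ler_wpM2l ?mulr_ge0 ?(ltW h0)//; case/andP: zz.
      by rewrite ler_wpM2r//; lra_from al0'.
    apply: le_trans e1 _; rewrite mulrDr [u x * _]mulrDr [h * u x]mulrC lerD2l//.
  have [xx1|x1x|xE] := ltgtP x x1.
  - have /andP[_ h1] := mvt x x1 ltac:(lra_from al0') xx1 ltac:(lra_from al0').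
    have /andP[h2 _] := mvt al x (lexx _) ltac:(lra_from al0') ltac:(lra_from al0').
    have [w0|w0] := leP (v x) 0.
      apply: easy; have : v x * (x1 - x) <= 0 by rewrite mulr_le0_ge0//; lra_from al0'.
      lra_from al0'.
    apply: (step (v x) (x1 - x)) => //; [exact: ltW|lra_from al0'|].
    have : v x * h <= v x * (x - al) by rewrite ler_pM2l//; lra_from al0'.
    have := up al ltac:(lra_from al0'); lra_from al0'.
  - have /andP[h1 _] := mvt x1 x ltac:(lra_from al0') x1x ltac:(lra_from al0').
    have /andP[_ h2] := mvt x be ltac:(lra_from al0') ltac:(lra_from al0') (lexx _).
    have [w0|w0] := leP 0 (v x).
      apply: easy; have : 0 <= v x * (x - x1) by rewrite mulr_ge0//; lra_from al0'.
      lra_from al0'.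
    apply: (step (- v x) (x - x1)); [lra_from al0'|lra_from al0'|lra_from al0'|].
    have : - v x * h <= - v x * (be - x) by rewrite ler_pM2l ?oppr_gt0//; lra_from al0'.
    have := up be ltac:(lra_from al0'); lra_from al0'.
  - by apply: easy; rewrite xE.
have u1 : u x1 <= r / q.
  rewrite leNgt; apply/negP => rM; rewrite ltr_pdivrMr// in rM.
  set k := _ + 1 in Gk.
  have Gb x : al + h <= x <= be - h -> k * (q * u x1) <= G (u x).
    move=> xh; have := qM x xh => h1; apply: le_trans (Gk _ _); last by rewrite mulrC in rM; lra_from al0'.
    by rewrite ler_pM2l// addr_gt0// divr_gt0// !mulr_gt0.
  have := acd_nondecreasing (ltW hab) (acdD (acdN (trajectory_acdv uv (al + h) (be - h)))
    (acdN (acdZ (k * (q * u x1)) (acd_primitive (al + h) (be - h) ai)))).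
  move=> /(_ _)/= H.
  have {}H : k * (q * u x1) * p <= v (al + h) - v (be - h).
    suff : - v (al + h) - k * (q * u x1) * primitive a (al + h) <=
       - v (be - h) - k * (q * u x1) * primitive a (be - h) by rewrite /p mulrBr; lra_from al0'.
    apply: H; apply: ae_imp a_ge0 => x ax xh.
    have ax0 : 0 <= a x by apply: ax; move: xh; rewrite !in_itv/=; lra_from al0'.
    rewrite opprK mulrC -mulrBl mulr_ge0// subr_ge0 Gb//.
    by move: xh; rewrite in_itv/=; lra_from al0'.
  have /andP[h1 _] := mvt al (al + h) (lexx _) ltac:(lra_from al0') ltac:(lra_from al0').
  have /andP[_ h2] := mvt (be - h) be ltac:(lra_from al0') ltac:(lra_from al0') (lexx _).
  rewrite (_ : al + h - al = h) in h1; last by ring.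
  rewrite (_ : be - (be - h) = h) in h2; last by ring.
  have h3 := x1max (al + h) ltac:(rewrite in_itv/=; lra_from al0').
  have h4 := x1max (be - h) ltac:(rewrite in_itv/=; lra_from al0').
  have h5 := up al ltac:(lra_from al0'); have h6 := up be ltac:(lra_from al0').
  have H2 : h * (k * (q * u x1) * p) <= 2 * u x1.
    apply: le_trans (_ : h * (v (al + h) - v (be - h)) <= _); first by rewrite ler_pM2l.
    by rewrite mulrBr [h * _]mulrC [h * v _]mulrC; lra_from al0'.
  have : h * (k * (q * u x1) * p) = 2 * u x1 + h * q * p * u x1.
    by rewrite /k; field; rewrite !gt_eqF.
  have : 0 < h * q * p * u x1 by rewrite !mulr_gt0.
  lra_from al0'.
by move=> x xab; apply: le_trans u1; apply: x1max; rewrite in_itv.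
Qed.

End concave_bound.

(** * Derivatives and continuity relative to a set *)

Section C1_in.
Variable R : realType.
Implicit Types (D : set R) (f : R -> R).

Lemma within_continuousP D f : {within D, continuous f} <->
  forall x, D x -> forall e, 0 < e -> exists2 d, 0 < d &
    forall y, D y -> `|y - x| < d -> `|f y - f x| <= e.
Proof.
rewrite subspace_continuousP; split=> H x Dx.
  move=> e e0; have /cvgrPdist_le/(_ e e0) := H x Dx.
  rewrite near_withinE => /nbhs_ballP[d d0 Hd]; exists d => // y Dy yx.
  rewrite distrC; apply: Hd => //; by rewrite /ball/= distrC.
apply/cvgrPdist_le => e e0; have [d d0 Hd] := H x Dx e e0.
rewrite near_withinE; apply/nbhs_ballP; exists d => // y.
by rewrite /ball/= distrC => yx Dy; rewrite distrC; apply: Hd.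
Qed.

Lemma has_derivative_in_is_derive D f (x l : R) : has_derivative_in D f x l ->
  (exists2 d, 0 < d & forall y, `|y - x| < d -> D y) -> is_derive x 1 f l.
Proof.
move=> /has_derivative_inP H [d d0 Dd]; apply/is_derive1P => e e0.
have [r r0 Hr] := H e e0; exists (Num.min d r); first by rewrite lt_min d0.
by move=> y; rewrite lt_min => /andP[h1 h2]; apply: Hr => //; exact: Dd.
Qed.

Lemma is_derive_has_derivative_in D f (x l : R) : is_derive x 1 f l ->
  has_derivative_in D f x l.
Proof.
move=> /is_derive1P H; apply/has_derivative_inP => e e0.
by have [d d0 Hd] := H e e0; exists d => // y _; exact: Hd.
Qed.

Lemma has_derivative_in_continuous D f (f' : R -> R) :
  (forall x, D x -> has_derivative_in D f x (f' x)) -> {within D, continuous f}.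
Proof.
move=> H; apply/within_continuousP => x Dx e e0.
have /has_derivative_inP/(_ 1 ltr01)[d d0 Hd] := H x Dx.
have c0 : 0 < `|f' x| + 1 by rewrite ltr_wpDl.
exists (Num.min d (e / (`|f' x| + 1))); first by rewrite lt_min d0 divr_gt0.
move=> y Dy; rewrite lt_min ltr_pdivlMr// => /andP[h1 h2].
have := Hd y Dy h1; rewrite mul1r => h3.
have := ler_normD (f y - f x - f' x * (y - x)) (f' x * (y - x)).
rewrite subrK normrM; move: h2; rewrite mulrDr mulr1 [`|y - x| * _]mulrC.
by lra.
Qed.

Lemma C1_in_MVT D f (f' : R -> R) s t : C1_in D f f' -> `[s, t]%classic `<=` D -> s < t ->
  exists2 x, s < x < t & f t - f s = f' x * (t - s).
Proof.
move=> [fd f'c] stD st; have [||x] := @MVT R f f' s t st; last first.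
- by rewrite in_itv/=; exists x.
- exact: continuous_subspaceW stD (has_derivative_in_continuous fd).
- move=> x; rewrite in_itv/= => xst; apply: has_derivative_in_is_derive.
    by apply: fd; apply: stD; rewrite /= in_itv/=; lra.
  exists (Num.min (x - s) (t - x)); first by rewrite lt_min; lra.
  move=> y; rewrite lt_min !ltr_distl => yx; apply: stD.
  by rewrite /= in_itv/=; lra.
Qed.

End C1_in.

(** * The nonlinearity and its truncation *)

Section truncation.
Variables (R : realType) (g g' : R -> R).
Hypothesis g_C1 : C1_in `[0, +oo[ g g'.
Hypothesis g0 : g 0 = 0.
Hypothesis g_gt0 : forall s : R, 0 < s -> 0 < g s.
Hypothesis g'_gt0 : forall s : R, 0 < s -> 0 < g' s.
Hypothesis g_lim0 : g s / s @[s --> (0 : R)^'+] --> 0.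
Hypothesis g_limy : g s / s @[s --> +oo] --> +oo.

Let g_MVT s t : 0 <= s -> s < t -> exists2 x, s < x < t & g t - g s = g' x * (t - s).
Proof.
move=> s0 st; apply: C1_in_MVT g_C1 _ st.
by move=> x /=; rewrite !in_itv/= andbT => /andP[sx _]; exact: le_trans sx.
Qed.

Lemma nonlinearity_mono s t : 0 <= s -> s <= t -> g s <= g t.
Proof.
move=> s0; rewrite le_eqVlt => /predU1P[->//|st]; rewrite -subr_ge0.
have [x /andP[sx _] ->] := g_MVT s0 st.
by rewrite mulr_ge0 ?subr_ge0 ?(ltW st)// ltW// g'_gt0// (le_lt_trans s0).
Qed.

Let g_ge0 s : 0 <= s -> 0 <= g s.
Proof. by move=> s0; rewrite -g0; exact: nonlinearity_mono. Qed.

Let lip_of_deriv r e : (forall x, 0 < x < r -> `|g' x| <= e) -> 0 <= e ->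
  forall s t, 0 <= s <= r -> 0 <= t <= r -> `|g s - g t| <= e * `|s - t|.
Proof.
move=> g'e e0.
have key s t : 0 <= s -> s < t -> t <= r -> `|g t - g s| <= e * `|t - s|.
  move=> s0 st tr; have [x xst ->] := g_MVT s0 st.
  by rewrite normrM ler_wpM2r// g'e//; lra.
move=> s t sr tr; have [st|ts|->] := ltgtP s t.
- by rewrite distrC [`|s - t|]distrC; apply: key => //; lra.
- by apply: key => //; lra.
- by rewrite !subrr normr0 mulr0.
Qed.

Lemma nonlinearity_lipschitz M : exists2 L, 0 < L &
  forall s t, 0 <= s <= M -> 0 <= t <= M -> `|g s - g t| <= L * `|s - t|.
Proof.
have [M0|M0] := ltP M 0; first by exists 1 => // s t sM; exfalso; lra.
have : {within `[0, M], continuous (fun x => `|g' x|)}.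
  have gc : {within `[0, M], continuous g'}.
    apply: continuous_subspaceW g_C1.2 => x /=.
    by rewrite !in_itv/= andbT => /andP[].
  by move=> x; apply: cvg_norm; exact: gc.
move=> /(EVT_max M0)[x _ xmax].
exists (`|g' x| + 1); first by rewrite ltr_wpDl.
apply: lip_of_deriv; last by rewrite addr_ge0.
move=> y yM; apply: le_trans (xmax y _) _; first by rewrite in_itv/=; lra.
by rewrite lerDl.
Qed.

(** The difference quotient of [g] at 0 is [g s / s], which tends to 0. *)
Let g'0 : g' 0 = 0.
Proof.
apply/eqP; rewrite -normr_le0; apply/ler_addgt0Pl => e e0; rewrite addr0.
have e2 : 0 < e / 2 by rewrite divr_gt0.
have D0 : `[(0 : R), +oo[%classic 0 by rewrite /= in_itv/= lexx.
have /has_derivative_inP/(_ _ e2)[d d0 Hd] := g_C1.1 _ D0.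
have /cvgrPdist_le/(_ _ e2) := g_lim0.
rewrite near_withinE => /nbhs_ballP[r /= r0 Hr].
pose y := Num.min (d / 2) (r / 2).
have y0 : 0 < y by rewrite lt_min !divr_gt0.
have [yd yr] : y <= d / 2 /\ y <= r / 2 by rewrite /y !ge_min !lexx orbT.
have /Hd : `[(0 : R), +oo[%classic y by rewrite /= in_itv/= ltW.
rewrite !subr0 g0 subr0 [`|y|]gtr0_norm// => /(_ ltac:(lra)) h1.
have /Hr/(_ y0) : ball 0 r y by rewrite /ball/= sub0r normrN gtr0_norm//; lra.
rewrite sub0r normrN => h2.
rewrite normrM normfV [`|y|]gtr0_norm// ler_pdivrMr// in h2.
rewrite -(ler_pM2r y0) -{1}[y]gtr0_norm// -normrM.
have := ler_normB (g y) (g y - g' 0 * y).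
rewrite opprB addrC subrK; have -> : e * y = e / 2 * y + e / 2 * y by field.
by lra.
Qed.

(** Continuity of [g'] at 0 makes [g'] at most [e] near 0; the mean value theorem turns this into a
    Lipschitz bound. *)
Lemma nonlinearity_small e : 0 < e -> exists2 r, 0 < r &
  forall s t, 0 <= s <= r -> 0 <= t <= r -> `|g s - g t| <= e * `|s - t|.
Proof.
move=> e0; have D0 : `[(0 : R), +oo[%classic 0 by rewrite /= in_itv/= lexx.
have [d d0 Hd] := (within_continuousP _ _).1 g_C1.2 _ D0 e e0.
exists (d / 2); first by rewrite divr_gt0.
apply: lip_of_deriv; last exact: ltW.
move=> x xd; have := Hd x; rewrite g'0 !subr0; apply.
  by rewrite /= in_itv/= andbT; lra.
by rewrite gtr0_norm; lra.
Qed.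

Lemma nonlinearity_superlinear k : exists2 r, 0 < r & forall s, r <= s -> k * s <= g s.
Proof.
have /cvgryPge/(_ k) [r [_ Hr]] := g_limy.
exists (Num.max r 0 + 1); first by rewrite ltr_wpDl// le_max lexx orbT.
move=> s rs; have [r1 r2] : r <= Num.max r 0 /\ 0 <= Num.max r 0.
  by rewrite !le_max !lexx orbT.
have s0 : 0 < s by lra.
by have := Hr s ltac:(lra); rewrite ler_pdivlMr.
Qed.

(** A sum of two nondecreasing Lipschitz terms. Above [M] it is the line through the origin of slope
    [g M / M], so that a bound [k s <= g s] valid at [M] persists beyond. *)
Definition truncation M s := g (Num.max 0 (Num.min s M)) + g M / M * Num.max 0 (s - M).

Section at_level.
Variable M : R.
Hypothesis M0 : 0 < M.

Let clamp s := Num.max 0 (Num.min s M).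

Let clampP s : [/\ 0 <= clamp s, clamp s <= M & 
  [\/ s <= 0 /\ clamp s = 0, 0 <= s <= M /\ clamp s = s | M <= s /\ clamp s = M]].
Proof.
have M0' := M0; rewrite /clamp; have [sM|Ms] := leP s M.
  have [s0|s0] := leP s 0; first by split; [|lra|constructor 1].
  by split => //; [exact: ltW|constructor 2; rewrite ltW].
rewrite max_r; last exact: ltW.
by split => //; [exact: ltW|constructor 3; split => //; exact: ltW].
Qed.

Let gM0 : 0 < g M / M. Proof. by rewrite divr_gt0// g_gt0. Qed.

Lemma truncation_nonpos s : s <= 0 -> truncation M s = 0.
Proof.
move=> s0; have M0' := M0; rewrite /truncation max_l ?g0; last by rewrite ge_min s0.
by rewrite max_l ?mulr0 ?addr0//; lra.
Qed.

Lemma truncation_id s : 0 <= s <= M -> truncation M s = g s.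
Proof.
move=> /andP[s0 sM]; rewrite /truncation min_l// max_r// max_l ?mulr0 ?addr0//.
by rewrite subr_le0.
Qed.

Lemma truncation_linear s : M <= s -> truncation M s = g M / M * s.
Proof.
move=> Ms; rewrite /truncation min_r// max_r ?ltW// max_r ?subr_ge0//.
by rewrite mulrBr divfK ?gt_eqF// addrC subrK.
Qed.

Lemma truncation_mono s t : s <= t -> truncation M s <= truncation M t.
Proof.
move=> st; rewrite lerD//.
  apply: nonlinearity_mono; first by have [] := clampP s.
  have [_ _ h1] := clampP s; have [_ _ h2] := clampP t; have M0' := M0.
  by rewrite -/(clamp s) -/(clamp t); case: h1 => -[? ->]; case: h2 => -[? ->]; lra.
rewrite ler_pM2l//; have [?|?] := leP 0 (s - M); have [?|?] := leP 0 (t - M); lra.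
Qed.

Lemma truncation_gt0 s : 0 < s -> 0 < truncation M s.
Proof.
move=> s0; rewrite ltr_pwDl//; last by rewrite mulr_ge0 ?(ltW gM0)// le_max lexx.
by apply: g_gt0; rewrite lt_max lt_min s0 M0 orbT.
Qed.

Lemma truncation_ge0 s : 0 <= truncation M s.
Proof.
have [s0|s0] := leP s 0; first by rewrite truncation_nonpos.
exact/ltW/truncation_gt0.
Qed.

Lemma truncation_lipschitz : exists2 L, 0 < L &
  forall s t, `|truncation M s - truncation M t| <= L * `|s - t|.
Proof.
have M0' := M0.
have [L L0 gL] := nonlinearity_lipschitz M.
exists (L + g M / M); first by rewrite addr_gt0.
have key s t : s <= t -> `|truncation M s - truncation M t| <= (L + g M / M) * `|s - t|.
  move=> st; rewrite distrC ger0_norm ?subr_ge0 ?truncation_mono//.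
  rewrite distrC ger0_norm ?subr_ge0//.
  have [s1 s2 s3] := clampP s; have [t1 t2 t3] := clampP t.
  have h1 : g (clamp t) - g (clamp s) <= L * (t - s).
    apply: le_trans (ler_norm _) _; apply: le_trans (gL _ _ _ _) _; [by rewrite t1|by rewrite s1|].
    rewrite ler_pM2l// ler_norml; case: s3 => -[? ->]; case: t3 => -[? ->]; lra.
  have h2 : g M / M * (Num.max 0 (t - M) - Num.max 0 (s - M)) <= g M / M * (t - s).
    rewrite ler_pM2l//; have [?|?] := leP 0 (t - M); have [?|?] := leP 0 (s - M); lra.
  rewrite mulrDl; apply: le_trans (lerD h1 h2).
  rewrite /truncation -/(clamp s) -/(clamp t) mulrBr; lra.
move=> s t; have [st|/ltW ts] := leP s t; first exact: key.
by rewrite distrC [`|s - t|]distrC; exact: key.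
Qed.

Lemma truncation_small e : 0 < e -> exists2 r, 0 < r &
  forall s t, 0 <= s <= r -> 0 <= t <= r ->
    `|truncation M s - truncation M t| <= e * `|s - t|.
Proof.
move=> e0; have [r r0 Hr] := nonlinearity_small e0.
exists (Num.min r M); first by rewrite lt_min r0.
by move=> s t; rewrite !le_min => /and3P[s0 sr sM] /and3P[t0 tr tM];
  rewrite !truncation_id ?s0 ?t0//; apply: Hr; rewrite ?s0 ?t0.
Qed.

Lemma truncation_superlinear k r : 0 < r -> r <= M ->
  (forall s, r <= s -> k * s <= g s) -> forall s, r <= s -> k * s <= truncation M s.
Proof.
move=> r0 rM gk s rs; have s0 : 0 < s by exact: lt_le_trans rs.
have [sM|Ms] := leP s M; first by rewrite truncation_id ?gk// ltW.
rewrite (truncation_linear (ltW Ms)) ler_pM2r// ler_pdivlMr//; exact: gk.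
Qed.

End at_level.

End truncation.

(** * Location of the maximum of a trajectory *)

Section max_location.
Variable R : realType.
Local Notation mu := (@lebesgue_measure R).

Lemma right_max_derive_le0 (f : R -> R) (x l h : R) : 0 < h -> is_derive x 1 f l ->
  (forall y, x <= y <= x + h -> f y <= f x) -> l <= 0.
Proof.
move=> h0 /is_derive1P fl fx; rewrite leNgt; apply/negP => l0.
have [d d0 Hd] := fl (l / 2) (divr_gt0 l0 (ltr0Sn _ 1)).
pose z := Num.min (d / 2) h.
have z0 : 0 < z by rewrite lt_min h0 divr_gt0.
have [zd zh] : z <= d / 2 /\ z <= h by rewrite /z !ge_min !lexx orbT.
have := Hd (x + z); have := fx (x + z).
rewrite [x + z - x]addrC addKr gtr0_norm// => h1 h2.
have := h2 ltac:(lra); rewrite ler_distl => /andP[h3 _].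
have := h1 ltac:(lra) => h4.
have lz : 0 < l * z by exact: mulr_gt0.
have E : l / 2 * z = (l * z) / 2 by field.
rewrite E in h3; lra.
Qed.

Lemma left_max_derive_ge0 (f : R -> R) (x l h : R) : 0 < h -> is_derive x 1 f l ->
  (forall y, x - h <= y <= x -> f y <= f x) -> 0 <= l.
Proof.
move=> h0 fl fx; rewrite -oppr_le0.
have fl' : is_derive (- x) 1 (fun y => f (- y)) (- l).
  apply/is_derive1P => e e0; have /is_derive1P/(_ e e0)[d d0 Hd] := fl.
  exists d => // y yx; have := Hd (- y).
  have -> : - y - x = - (y - - x) by ring.
  rewrite normrN => /(_ yx); rewrite opprK.
  by rewrite mulrN mulNr.
apply: (right_max_derive_le0 h0 fl') => y yx; rewrite opprK.
by apply: fx; lra.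
Qed.

Variables (T : R) (a G : R -> R) (m : nat) (lo hi : 'I_m -> R).
Hypothesis ai : mu.-integrable setT (EFin \o a).
Hypothesis m1 : (1 <= m)%N.
Hypothesis G0 : forall s, 0 <= G s.
Hypothesis lohi : forall i, [/\ 0 <= lo i, lo i <= hi i & hi i <= T].
Hypothesis a_le0 : {ae mu, forall x : R, x \in `]0, T[ ->
  (forall i, ~ lo i <= x <= hi i) -> a x <= 0}.

(* Outside the intervals u is convex, so from a critical point of u one moves to
   the nearest interval without decreasing u. *)
Lemma max_attained_in_supports u v x : trajectory T a G u v -> 0 <= x <= T -> v x = 0 ->
  exists i y, lo i <= y <= hi i /\ u x <= u y.
Proof.
move=> uv /andP[x0 xT] vx.
have [[i xi]|nxi] := pselect (exists i, lo i <= x <= hi i); first by exists i, x.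
pose i0 := Ordinal m1.
have vmono s t : 0 <= s -> s <= t -> t <= T ->
    (forall y, s < y < t -> forall i, ~ lo i <= y <= hi i) -> v s <= v t.
  move=> s0 st tT sty; apply: (acd_nondecreasing st (trajectory_acdv uv s t)).
  apply: ae_imp a_le0 => y ay yst; rewrite in_itv/= in yst.
  rewrite oppr_ge0 mulr_le0_ge0// ay//; last exact: sty.
  by rewrite in_itv/=; lra.
have [h|h] : x < lo i0 \/ hi i0 < x.
  have [h|h] := ltP x (lo i0); first by left.
  have [h'|h'] := ltP (hi i0) x; first by right.
  by case: nxi; exists i0; rewrite h.
- have [i xi imin] := @arg_minP _ _ _ i0 (fun i => x < lo i) lo h.
  have [i1 i2 i3] := lohi i.
  exists i, (lo i); rewrite lexx i2; split => //.
  have gap y : x < y < lo i -> forall j, ~ lo j <= y <= hi j.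
    move=> xy j yj; have [xj|jx] := ltP x (lo j); first by have := imin j xj; lra.
    by apply: nxi; exists j; lra.
  have [y xy] := trajectory_MVT uv x0 xi (le_trans i2 i3).
  rewrite -subr_ge0 => ->; apply: mulr_ge0; last by rewrite subr_ge0 ltW.
  rewrite -vx; apply: vmono => //; [lra|lra|].
  by move=> z zy; apply: gap; lra.
- have [i xi imax] := @arg_maxP _ _ _ i0 (fun i => hi i < x) hi h.
  have [i1 i2 i3] := lohi i.
  exists i, (hi i); rewrite lexx i2; split => //.
  have gap y : hi i < y < x -> forall j, ~ lo j <= y <= hi j.
    move=> xy j yj; have [xj|jx] := ltP (hi j) x; first by have := imax j xj => /=; lra.
    by apply: nxi; exists j; lra.
  have [y xy] := trajectory_MVT uv (le_trans i1 i2) xi xT.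
  rewrite -subr_le0 => ->; apply: mulr_le0_ge0; last by rewrite subr_ge0 ltW.
  rewrite -vx; apply: vmono => //; [lra|lra|].
  by move=> z zy; apply: gap; lra.
Qed.

End max_location.

(** * The boundary value problems *)

Section indefinite_problem.
Variables (R : realType) (T : R) (g g' a : R -> R).
Local Notation mu := (@lebesgue_measure R).
Hypothesis T0 : 0 < T.
Hypothesis g_C1 : C1_in `[0, +oo[ g g'.
Hypothesis g0 : g 0 = 0.
Hypothesis g_gt0 : forall s : R, 0 < s -> 0 < g s.
Hypothesis g'_gt0 : forall s : R, 0 < s -> 0 < g' s.
Hypothesis g_lim0 : g s / s @[s --> (0 : R)^'+] --> 0.
Hypothesis g_limy : g s / s @[s --> +oo] --> +oo.
Hypothesis a_L1 : mu.-integrable `[0, T] (EFin \o a).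
Variables (m : nat) (lo hi : 'I_m -> R).
Hypothesis m_ge1 : (1 <= m)%N.
Hypothesis I_sub : forall i, `[lo i, hi i]%classic `<=` `[0, T]%classic.
Hypothesis a_ge0 : forall i, {ae mu, forall x, x \in `[lo i, hi i] -> 0 <= a x}.
Hypothesis a_neq0 : forall i, ~ {ae mu, forall x, x \in `[lo i, hi i] -> a x = 0}.
Hypothesis a_le0 : {ae mu, forall x,
  (`[0, T]%classic `\` \bigcup_i `[lo i, hi i]%classic) x -> a x <= 0}.

Lemma ae_neq (c : R) : {ae mu, forall x : R, x <> c}.
Proof.
exists [set c]; split => //; first exact: lebesgue_measure_set1.
by move=> x /= /contrapT.
Qed.

(** The point 0 is left out, so that the extension vanishes for all [x <= 0], as the initial value
    problem requires. *)
Let ext := a \_ `]0, T].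

Let ext_in x : 0 < x <= T -> ext x = a x.
Proof. by move=> x0; rewrite /ext patchE ifT// inE/= in_itv. Qed.

Let ext_nonpos x : x <= 0 -> ext x = 0.
Proof.
move=> x0; rewrite /ext patchE ifF//; apply/negbTE.
by rewrite notin_setE/= in_itv/=; apply/negP; lra.
Qed.

Let ext_integrable : mu.-integrable setT (EFin \o ext).
Proof.
rewrite /ext -restrict_EFin; apply/integrable_restrict => //; rewrite setTI.
apply: integrableS a_L1 => //; exact: subset_itv_oc_cc.
Qed.

Lemma ext_int : primitive ext T = \int[mu]_(x in `[0, T]) a x.
Proof.
have -> : primitive ext T = primitive ext T - primitive ext 0.
  by rewrite (primitive_eq0 ext_nonpos) subr0.
rewrite primitiveB ?ltW//.
rewrite -(@Rintegral_itv_obnd_cbnd R 0 (BRight T) a); last first.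
  by apply: integrableS a_L1 => //; exact: subset_itv_oc_cc.
by apply: eq_Rintegral => x; rewrite inE/= in_itv/= => x0; rewrite ext_in.
Qed.

(** An empty or one-point interval is a null set, on which [a] would be zero almost everywhere. *)
Let lohi i : [/\ 0 <= lo i, lo i < hi i & hi i <= T].
Proof.
have lh : lo i < hi i.
  rewrite ltNge; apply/negP => hl; apply: (@a_neq0 i).
  apply: ae_imp (ae_neq (lo i)) => x xlo; rewrite in_itv/= => xlh.
  by exfalso; apply: xlo; lra.
have H := @I_sub i; split => //.
  by have /H/= : `[lo i, hi i]%classic (lo i); rewrite /= in_itv/= ?lexx ?(ltW lh)// => /andP[].
by have /H/= : `[lo i, hi i]%classic (hi i); rewrite /= in_itv/= ?lexx ?(ltW lh)// => /andP[].
Qed.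

Let sub_oT i x : x \in `]lo i, hi i[ -> 0 < x <= T.
Proof. by have [? ? ?] := lohi i; rewrite in_itv/=; lra. Qed.

Let ext_ge0 i : {ae mu, forall x : R, x \in `]lo i, hi i[ -> 0 <= ext x}.
Proof.
apply: ae_imp (a_ge0 i) => x h xi; rewrite ext_in ?(sub_oT xi)//.
by apply: h; exact: subset_itv_oo_cc xi.
Qed.

Let ext_neq0 i : ~ {ae mu, forall x : R, x \in `]lo i, hi i[ -> ext x = 0}.
Proof.
move=> H; apply: (@a_neq0 i).
have := ae_and H (ae_and (ae_neq (lo i)) (ae_neq (hi i))).
apply: ae_imp => x [h [xl xh]]; rewrite in_itv/= => /andP[lx hx].
have xi : x \in `]lo i, hi i[.
  rewrite in_itv/= !lt_neqAle lx hx !andbT; apply/andP; split; apply/negP => /eqP E.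
    exact: xl.
  exact: xh.
by rewrite -ext_in ?(sub_oT xi)// h.
Qed.

Let ext_le0 : {ae mu, forall x : R, x \in `]0, T[ ->
  (forall i, ~ lo i <= x <= hi i) -> ext x <= 0}.
Proof.
apply: ae_imp a_le0 => x h; rewrite in_itv/= => x0 nx; rewrite ext_in; last lra.
apply: h; split; first by rewrite /= in_itv/=; lra.
by move=> [i _]; rewrite /= in_itv/=; exact: nx.
Qed.

Lemma positive_solution_exists (bc : boundary_condition) :
  \int[mu]_(x in `[0, T]) a x < 0 -> exists u : R -> R, is_positive_solution T a g bc u.
Proof.
rewrite -ext_int => a_neg; have T0' := T0.
(* The constants of [concave_bound] depend on [a] alone, so that the truncation level may be chosen
   after them. *)
have cb i := let: And3 h1 h2 h3 := lohi i in
  concave_bound ext_integrable h1 h3 (ext_ge0 i) (@ext_neq0 i).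
have [k Hk] := choice cb; have [q Hq] := choice Hk.
(* The sums [kk] and [M1] of positive terms dominate each term, and so serve for all the intervals
   at once. *)
pose kk := \sum_i k i.
have kpos i : 0 < k i by have [] := Hq i.
have qpos i : 0 < q i by have [] := Hq i.
have kkk i : k i <= kk.
  by rewrite /kk (bigD1 i)//= lerDl sumr_ge0// => j _; exact: ltW.
have [r r0 gr] := nonlinearity_superlinear g_limy kk.
pose M1 := \sum_i r / q i.
have rq i : r / q i <= M1.
  by rewrite /M1 (bigD1 i)//= lerDl sumr_ge0// => j _; rewrite ltW// divr_gt0.
have M10 : 0 <= M1 by rewrite sumr_ge0// => j _; rewrite ltW// divr_gt0.
(* The level is at least [r], to keep superlinearity from [r] on, and at least [M1], so that the
   solution remains where [G] equals [g]. *)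
pose M := M1 + r.
have M0 : 0 < M by rewrite /M; lra_from bc.
pose G := truncation g M.
have [L L0 GL] := truncation_lipschitz g_C1 g_gt0 g'_gt0 M0.
have Gnonpos s : s <= 0 -> G s = 0 by exact: truncation_nonpos.
have Gge0 s : 0 <= G s by exact: truncation_ge0.
have apriori u v i x : trajectory T ext G u v -> (forall x, 0 <= x <= T -> 0 < u x) ->
    lo i <= x <= hi i -> u x <= M1.
  move=> uv up xi; apply: le_trans (rq i).
  have [_ _ H] := Hq i; apply: (H G u v r uv) => //.
  - move=> s rs; apply: le_trans (_ : kk * s <= _); first by rewrite ler_wpM2r//; lra_from bc.
    by apply: (truncation_superlinear M0 r0) rs => //; rewrite /M; lra_from bc.
  - by move=> y yi; apply: up; have [? ? ?] := lohi i; lra_from bc.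
pose i0 := Ordinal m_ge1.
pose C := growth_constant T ext L * (M1 + M1 / (hi i0 - lo i0)) + 1.
have Cb u v : trajectory T ext G u v -> (forall x, 0 <= x <= T -> 0 < u x) ->
    `|u 0| + `|v 0| < C.
  move=> uv up; have [l0 lh hT] := lohi i0.
  rewrite /C ltr_pwDr//; apply: (trajectory_data_bound T0 ext_integrable L0 GL Gnonpos uv l0 lh hT).
  move=> x xi; rewrite (apriori u v i0)// andbT ltW// up//; lra_from bc.
have [u [v [uv up bcu]]] : exists u v, [/\ trajectory T ext G u v,
    forall x, 0 <= x <= T -> 0 < u x & boundary_operator bc T u v = (0, 0)].
  have Gm := truncation_mono g_C1 g_gt0 g'_gt0 M0.
  have Gp := truncation_gt0 g_gt0 M0.
  have Gs := truncation_small g_C1 g0 g_lim0 M0.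
  case: bc.
    have [u [v [uv up v0 vT]]] := neumann_shooting T0 ext_integrable ext_nonpos L0 GL
      Gnonpos Gm Gp Gs a_neg Cb.
    by exists u, v; split => //=; rewrite v0 vT.
  have [u [v [uv up u0 v0]]] := periodic_shooting T0 ext_integrable ext_nonpos L0 GL
    Gnonpos Gm Gp Gs a_neg Cb.
  by exists u, v; split => //=; rewrite u0 v0 !subrr.
have [_ i uc ud] := uv.
have uM x : 0 <= x <= T -> u x <= M1.
  have [y yT ymax] := EVT_max (ltW T0) (continuous_subspaceT uc).
  move=> xT; apply: le_trans (ymax x _) _; first by rewrite in_itv.
  have {}ymax z : 0 <= z <= T -> u z <= u y by move=> zT; apply: ymax; rewrite in_itv.
  rewrite in_itv/= in yT.
  have vle z : 0 <= z -> z < T -> (forall w, 0 <= w <= T -> u w <= u z) -> v z <= 0.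
    move=> z0 zT zmax; apply: (@right_max_derive_le0 R u z (v z) (T - z)); first lra_from bc.
      by apply: ud; lra_from bc.
    by move=> w wz; apply: zmax; lra_from bc.
  have vge z : 0 < z -> z <= T -> (forall w, 0 <= w <= T -> u w <= u z) -> 0 <= v z.
    move=> z0 zT zmax; apply: (@left_max_derive_ge0 R u z (v z) z) => //.
      by apply: ud; lra_from bc.
    by move=> w wz; apply: zmax; lra_from bc.
  (* At an endpoint the boundary condition decides: for Neumann it is the claim; for periodic data
     both endpoints are maxima, so that [v 0 <= 0 <= v T = v 0]. *)
  have vy : v y = 0.
    have [y0|y0|yE] := ltgtP y 0; first by exfalso; lra_from bc.
      have [yT'|yT'|yE] := ltgtP y T; [|by exfalso; lra_from bc|].
        by apply/eqP; rewrite eq_le vle ?vge//; lra_from bc.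
      have := vge y y0 ltac:(lra_from bc) ymax.
      move: bcu; rewrite /= yE; case: bc => /= -[]; first by [].
      move=> u0T v0T vT.
      have v0 : v 0 <= 0.
        apply: vle => // w wT; apply: le_trans (ymax w wT) _.
        by rewrite yE; lra_from bc.
      by apply/eqP; rewrite eq_le vT andbT; lra_from bc.
    move: bcu; rewrite yE /=; case: bc => /= -[]; first by [].
    move=> u0T v0T.
    have v0 : v 0 <= 0 by apply: vle => // w wT; rewrite -yE; exact: ymax.
    have vT : 0 <= v T.
      apply: vge => // w wT; apply: le_trans (ymax w wT) _.
      by rewrite yE; lra_from bc.
    by apply/eqP; rewrite eq_le v0/=; lra_from bc.
  have lohi' j : [/\ 0 <= lo j, lo j <= hi j & hi j <= T].
    by have [? /ltW ? ?] := lohi j.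
  have [j [z [zj uyz]]] := max_attained_in_supports m_ge1 Gge0 lohi' ext_le0 uv yT vy.
  exact: le_trans uyz (apriori u v j z uv up zj).
exists u; split; last by move=> x; rewrite in_itv; exact: up.
exists v; split => //.
- split; last first.
    apply: continuous_subspaceT => x.
    have -> : v = (fun t => v 0 - primitive (fun x => ext x * G (u x)) t) by have [] := uv.
    by apply: cvgB; [exact: cvg_cst|exact: primitive_continuous].
  move=> x; rewrite /= in_itv/= => xT; apply: is_derive_has_derivative_in.
  by apply: ud; lra_from bc.
- exact: (trajectory_acdv uv 0 T).1.
have := ae_and (trajectory_acdv uv 0 T).2 (ae_and (ae_neq 0) (ae_neq T)).
apply: ae_imp => x [vd [x0 xT]]; rewrite in_itv/= => /andP[x0' xT'].
have xoT : 0 < x < T.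
  rewrite !lt_neqAle x0' xT' !andbT; apply/andP; split; apply/negP => /eqP E.
    exact: x0.
  exact: xT.
exists (- (ext x * G (u x))); split.
  by apply: is_derive_has_derivative_in; apply: vd; rewrite in_itv.
have uxp := up x ltac:(lra_from bc); have uxM := uM x ltac:(lra_from bc).
rewrite ext_in; last lra_from bc.
by rewrite /G truncation_id ?addNr// ltW//= /M; lra_from bc.
Qed.

Lemma positive_solution_necessary (bc : boundary_condition) (u : R -> R) :
  is_positive_solution T a g bc u -> \int[mu]_(x in `[0, T]) a x < 0.
Proof.
move=> [[v [uC1 vac vd bcu]] up]; have T0' := T0.
have {}up x : 0 <= x <= T -> 0 < u x by move=> xT; apply: up; rewrite in_itv.
have uc := has_derivative_in_continuous uC1.1.
have inT x : 0 < x < T -> exists2 d, 0 < d & forall y, `|y - x| < d -> `[0, T]%classic y.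
  move=> xT; exists (Num.min x (T - x)); first by rewrite lt_min; lra_from bc.
  by move=> y; rewrite lt_min !ltr_distl /= in_itv/= => yx; lra_from bc.
have ud x : 0 < x < T -> is_derive x (1 : R) u (v x).
  move=> xT; apply: has_derivative_in_is_derive (inT x xT).
  by apply: uC1.1; rewrite /= in_itv/=; lra_from bc.
have vacd : acd 0 T v (fun x => - (a x * g (u x))).
  split => //; apply: ae_imp vd => x vx; rewrite in_itv/= => xT.
  have [|w [wx wE]] := vx; first by rewrite in_itv/=; lra_from bc.
  have -> : - (a x * g (u x)) = w by lra_from bc.
  exact: has_derivative_in_is_derive wx (inT x xT).
have [K vK] := ac_bounded vac.
have uacd : acd 0 T u v.
  apply: (@acd_C1 _ _ _ _ _ K) => //.
  by move=> x; rewrite in_itv/= => xT; apply: vK; lra_from bc.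
have gd (s : R) : 0 < s -> is_derive s (1 : R) g (g' s).
  move=> s0; apply: has_derivative_in_is_derive (g_C1.1 s _) _.
    by rewrite /= in_itv/= andbT ltW.
  by exists s => // y; rewrite ltr_distl /= in_itv/= andbT => ys; lra_from bc.
pose q x := (g (u x))^-1.
have gu x : 0 <= x <= T -> 0 < g (u x) by move=> xT; apply: g_gt0; exact: up.
(* On [[0, T]] the function [g (u x)] is at least [c > 0], the value at the minimum of [u], and [g]
   is Lipschitz up to the maximum of [u]. *)
have qac : absolutely_continuous 0 T q.
  have [x1 x1T x1min] := EVT_min (ltW T0) uc.
  have [x2 x2T x2max] := EVT_max (ltW T0) uc.
  rewrite !in_itv/= in x1T x2T.
  have [L L0 gL] := nonlinearity_lipschitz g_C1 (u x2).
  have uM x : 0 <= x <= T -> u x1 <= u x <= u x2.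
    by move=> xT; rewrite x1min ?x2max// in_itv.
  have c0 := gu x1 x1T; set c := g (u x1) in c0.
  have gc x : 0 <= x <= T -> c <= g (u x).
    move=> xT; have /andP[h _] := uM x xT.
    by apply: (nonlinearity_mono g_C1 g'_gt0 _ h); exact/ltW/up.
  apply: (ac_le_lincomb (K := L / (c * c)) (L := 0) _ _ uacd.1 uacd.1) => //.
    by rewrite divr_ge0 ?mulr_ge0// ltW.
  move=> s t s0 st tT; have sT : 0 <= s <= T by lra_from bc.
  have tT' : 0 <= t <= T by lra_from bc.
  have gs := gu s sT; have gt := gu t tT'; have gcs := gc s sT; have gct := gc t tT'.
  rewrite mul0r addr0.
  have -> : q t - q s = (g (u s) - g (u t)) / (g (u s) * g (u t)).
    by rewrite /q; field; rewrite !gt_eqF.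
  rewrite normrM normfV [`|g (u s) * _|]gtr0_norm ?mulr_gt0//.
  rewrite mulrAC; apply: ler_pM => //; first by rewrite invr_ge0 mulr_ge0// ltW.
    rewrite distrC; apply: gL; first by have := uM t tT'; have := up t tT'; lra_from bc.
    by have := uM s sT; have := up s sT; lra_from bc.
  by rewrite lef_pV2 ?posrE ?mulr_gt0// ler_pM// ltW.
have qacd : acd 0 T q (fun x => - (q x ^+ 2 * (g' (u x) * v x))).
  split => //; apply: aeW => x; rewrite in_itv/= => xT.
  have gx := gu x ltac:(lra_from bc); have gdx := gd (u x) (up x ltac:(lra_from bc)); have udx := ud x xT.
  have comp : is_derive x (1 : R) (g \o u) (g' (u x) * v x) by apply: is_derive1_comp.
  have := @is_deriveV R (g \o u) x _ 1 (lt0r_neq0 gx) comp.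
  by rewrite /= -exprVn scaleNr.
have := acdD (acdM vacd qacd) (acd_primitive 0 T ext_integrable).
(* In [p] the term [- a g(u) / g(u)] cancels [ext], which leaves [- g'(u) (v q)^2]. *)
set P := _ \+ primitive ext; set p := _ \+ ext => Pacd.
have pE x : x \in `]0, T[ -> p x = - (g' (u x) * (v x * q x) ^+ 2).
  rewrite in_itv/= => xT; have gx := gu x ltac:(lra_from bc).
  rewrite /p/= ext_in; last lra_from bc.
  by rewrite /q; field; rewrite gt_eqF.
have Pmono s t : 0 <= s -> s <= t -> t <= T -> P t <= P s.
  move=> s0 st tT; rewrite -lerN2.
  apply: (acd_nondecreasing st (acdN (acdS s0 tT Pacd))).
  apply: aeW => x; rewrite in_itv/= => xst /=.
  rewrite pE; last by rewrite in_itv/=; lra_from bc.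
  rewrite opprK mulr_ge0 ?sqr_ge0//; apply/ltW/g'_gt0/up; lra_from bc.
have P0T : P T - P 0 = \int[mu]_(x in `[0, T]) a x.
  rewrite -ext_int /P/= (primitive_eq0 ext_nonpos) addr0.
  suff -> : v T * q T = v 0 * q 0 by rewrite addrC addKr.
  move: bcu; case: bc => /= -[].
    by move=> -> ->; rewrite !mul0r.
  by rewrite /q => /eqP + /eqP; rewrite !subr_eq0 => /eqP-> /eqP->.
rewrite -P0T lt_neqAle subr_le0 Pmono ?lexx ?ltW// andbT.
(* In the case of equality [P] is constant, whence [v = 0], [u] is constant and [a g(u) = 0] almost
   everywhere, against the choice of any one interval. *)
apply/negP => /eqP/subr0_eq PT.
have Pcst s : 0 <= s <= T -> P s = P 0.
  move=> sT; apply/eqP; rewrite eq_le Pmono ?lexx//=; [|lra_from bc|lra_from bc].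
  by rewrite -PT Pmono//; lra_from bc.
have v0 : {ae mu, forall x : R, x \in `]0, T[ -> v x = 0}.
  apply: ae_imp Pacd.2 => x Px xT; have Pdx := Px xT.
  have Pd0 : is_derive x (1 : R) P 0.
    rewrite in_itv/= in xT.
    apply/is_derive1P => e e0; have [d d0 Hd] := inT x xT.
    exists d => // y /Hd; rewrite /= in_itv/= => yT.
    by rewrite (Pcst y)// (Pcst x); [rewrite subrr mul0r subr0 normr0 mulr_ge0// ltW|lra_from bc].
  have : p x = 0 by rewrite -(@derive_val _ _ _ _ _ _ _ Pdx) (@derive_val _ _ _ _ _ _ _ Pd0).
  rewrite pE// => /eqP; rewrite in_itv/= in xT.
  rewrite oppr_eq0 mulf_eq0 gt_eqF/=; last by apply/g'_gt0/up; lra_from bc.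
  by rewrite sqrf_eq0 mulf_eq0 invr_eq0 [g _ == 0]gt_eqF ?orbF ?gu//; [move/eqP|lra_from bc].
have ucst s t : 0 <= s -> s <= t -> t <= T -> u t = u s.
  move=> s0 st tT; have ust := acdS s0 tT uacd.
  have v0' : {ae mu, forall x : R, x \in `]s, t[ -> v x = 0}.
    by apply: ae_imp v0 => x h; rewrite in_itv/= => xst; apply: h; rewrite in_itv/=; lra_from bc.
  apply/eqP; rewrite eq_le; apply/andP; split.
    rewrite -lerN2; apply: (acd_nondecreasing st (acdN ust)).
    by apply: ae_imp v0' => x h /h /= ->; rewrite oppr0.
  apply: (acd_nondecreasing st ust).
  by apply: ae_imp v0' => x h /h ->.
(* Everywhere rather than almost everywhere, so that the derivative of [v] can be computed. *)
have vz x : 0 < x < T -> v x = 0.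
  move=> xT; have udx := ud x xT.
  have ud0 : is_derive x (1 : R) u 0.
    apply/is_derive1P => e e0; have [d d0 Hd] := inT x xT.
    exists d => // y /Hd; rewrite /= in_itv/= => yT.
    rewrite (ucst 0 y) ?(ucst 0 x)//; [|lra_from bc..].
    by rewrite subrr mul0r subr0 normr0 mulr_ge0// ltW.
  by rewrite -(@derive_val _ _ _ _ _ _ _ udx) (@derive_val _ _ _ _ _ _ _ ud0).
pose i0 := Ordinal m_ge1; apply: (@ext_neq0 i0).
have [l0 lh hT] := lohi i0.
apply: ae_imp vacd.2 => x vx; rewrite in_itv/= => xi.
have xT : 0 < x < T by lra_from bc.
have vdx := vx (ltac:(by rewrite in_itv)).
have vd0 : is_derive x (1 : R) v 0.
  apply/is_derive1P => e e0; exists (Num.min x (T - x)); first by rewrite lt_min; lra_from bc.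
  move=> y; rewrite lt_min !ltr_distl => yx.
  rewrite (vz y) ?(vz x)//; last lra_from bc.
  by rewrite subrr mul0r subr0 normr0 mulr_ge0// ltW.
have : - (a x * g (u x)) = 0.
  by rewrite -(@derive_val _ _ _ _ _ _ _ vdx) (@derive_val _ _ _ _ _ _ _ vd0).
move=> /eqP; rewrite oppr_eq0 mulf_eq0 [g _ == 0]gt_eqF ?orbF ?gu//; last lra_from bc.
by move=> /eqP a0; rewrite ext_in ?a0//; lra_from bc.
Qed.

End indefinite_problem.

Theorem corollary3p6 (R : realType) (T : R) (T_gt0 : 0 < T)
  (g g' : R -> R)
  (g_ge0 : forall s : R, 0 <= s -> 0 <= g s)
  (g_C1 : C1_in `[0, +oo[ g g')
  (g0 : g 0 = 0)
  (g_gt0 : forall s : R, 0 < s -> 0 < g s)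
  (g'_gt0 : forall s : R, 0 < s -> 0 < g' s)
  (g_lim0 : g s / s @[s --> (0 : R)^'+] --> 0)
  (g_limy : g s / s @[s --> +oo] --> +oo)
  (a : R -> R)
  (a_L1 : (@lebesgue_measure R).-integrable `[0, T] (EFin \o a))
  (m : nat) (m_ge1 : (1 <= m)%N)
  (lo hi : 'I_m -> R)
  (I_sub : forall i, `[lo i, hi i]%classic `<=` `[0, T]%classic)
  (I_disj : trivIset setT (fun i => `[lo i, hi i]%classic))
  (a_ge0 : forall i, {ae (@lebesgue_measure R),
     forall x, x \in `[lo i, hi i] -> 0 <= a x})
  (a_neq0 : forall i, ~ {ae (@lebesgue_measure R),
     forall x, x \in `[lo i, hi i] -> a x = 0})
  (a_le0 : {ae (@lebesgue_measure R), forall x,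
     (`[0, T]%classic `\` \bigcup_i `[lo i, hi i]%classic) x -> a x <= 0})
  (bc : boundary_condition) :
  (exists u : R -> R, is_positive_solution T a g bc u) <->
  \int[@lebesgue_measure R]_(x in `[0, T]) a x < 0.
Proof.
split=> [[u upos]|].
  exact: (positive_solution_necessary T_gt0 g_C1 g_gt0 g'_gt0 a_L1 m_ge1 I_sub
    a_neq0 upos).
exact: (positive_solution_exists T_gt0 g_C1 g0 g_gt0 g'_gt0 g_lim0 g_limy a_L1
  m_ge1 I_sub a_ge0 a_neq0 a_le0).
Qed.
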